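(* Fix an integer $k\ge 0$ and constants $C>0$, $M>0$, $\sigma>0$. For each $n$, let $x_i=i/n$, $i=1,\ldots,n$, and let $y\in\mathbb{R}^n$ be drawn from the model $y_i=f_0(x_i)+\varepsilon_i$, $i=1,\ldots,n$, where $\varepsilon_1,\ldots,\varepsilon_n$ are i.i.d. with $\mathbb{E}[\varepsilon_i]=0$ and $\mathbb{P}(|\varepsilon_i|>t)\le M\exp(-t^2/(2\sigma^2))$ for all $t>0$. Assume that $f_0\in\mathcal{F}_k(C)$, i.e. $f_0:[0,1]\to\mathbb{R}$ is $k$ times weakly differentiable and $\mathrm{TV}(f_0^{(k)})\le C$. Then, for a tuning parameter value $\lambda=\Theta(n^{1/(2k+3)})$, the $k$th order trend filtering estimate $\hat\beta$ satisfies, as $n\to\infty$, $$\frac1n\sum_{i=1}^n\bigl(\hat\beta_i-f_0(x_i)\bigr)^2=O_{\mathbb{P}}\bigl(n^{-(2k+2)/(2k+3)}\bigr).$$ Hence the trend filtering estimate converges in probability to $f_0$ (in squared error averaged over the inputs) at the minimax rate $n^{-(2k+2)/(2k+3)}$.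
   Context: Total variation: $\mathrm{TV}(f)=\sup\{\sum_{i=1}^{p-1}|f(z_{i+1})-f(z_i)| : z_1<\cdots<z_p \text{ a partition of }[0,1]\}$. $f^{(k)}$ denotes the $k$th weak derivative of $f$ ($f^{(0)}=f$). $A_n=O_{\mathbb P}(B_n)$ means $A_n/B_n$ is bounded in probability; $a_n=\Theta(b_n)$ means $a_n=O(b_n)$ and $b_n=O(a_n)$. Trend filtering: the discrete difference operators are defined by $D^{(1)}$ with $(D^{(1)}\beta)_i=\beta_{i+1}-\beta_i$ (of size $(m-1)\times m$ when acting on $\mathbb{R}^m$), and recursively $D^{(k+1)}=D^{(1)}D^{(k)}\in\mathbb{R}^{(n-k-1)\times n}$, where here $D^{(1)}$ has size $(n-k-1)\times(n-k)$. The $k$th order trend filtering estimate with tuning parameter $\lambda\ge0$ is the unique minimizer $$\hat\beta=\operatorname{argmin}_{\beta\in\mathbb{R}^n}\ \tfrac12\|y-\beta\|_2^2+\frac{n^k}{k!}\,\lambda\,\|D^{(k+1)}\beta\|_1 .$$ ''The minimax rate'' refers to the rate $n^{-(2k+2)/(2k+3)}$ for estimation over $\mathcal{F}_k(C)$; it is a known fact that, for $C>1$, $\min_{\hat f}\max_{f_0\in\mathcal{F}_k(C)}\mathbb{E}[\frac1n\sum_{i=1}^n(\hat f(x_i)-f_0(x_i))^2]=\Omega(n^{-(2k+2)/(2k+3)})$, the minimum being over all estimators. *)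

(* Defs.v *)
From HB Require Import structures.
From mathcomp Require Import all_boot all_order all_algebra.
From mathcomp Require Import all_classical all_reals all_analysis.

Set Implicit Arguments.
Unset Strict Implicit.
Unset Printing Implicit Defensive.

Import Order.TTheory GRing.Theory Num.Theory.
Import numFieldNormedType.Exports.

Local Open Scope classical_set_scope.
Local Open Scope ring_scope.

Section FunctionClass.
Context {R : realType}.
Implicit Types (f g phi : R -> R) (k : nat) (C : R).

(* Smooth functions with compact support contained in ]0, 1[. *)
Definition test_function phi : Prop :=
  [/\ forall (j : nat) (x : R), derivable (derive1n j phi) x 1,
      compact (closure [set x | phi x != 0]) &
      closure [set x | phi x != 0] `<=` `]0, 1[%classic].

Definition weak_derivative f g : Prop :=
  [/\ locally_integrable `]0, 1[%classic f,
      locally_integrable `]0, 1[%classic g &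
      forall phi, test_function phi ->
        \int[lebesgue_measure]_(x in `]0, 1[%classic) (f x * derive1 phi x) =
        - \int[lebesgue_measure]_(x in `]0, 1[%classic) (g x * phi x)].

(* The class F_k(C).  Functions on [0, 1] are represented by functions on R
   whose values outside [0, 1] play no role.  [D j] is the j-th weak derivative;
   it is determined only almost everywhere when [0 < j], and the total
   variation bound is on some version of the k-th one.  When [0 < k] a weakly
   differentiable function is itself determined only almost everywhere, and the
   pointwise values f (i / n) are those of its continuous version. *)
Definition in_class k C f : Prop :=
  ((0 < k)%N -> {within `[0, 1], continuous f}) /\
  exists D : nat -> R -> R,
    [/\ D 0%N = f,
        forall j : nat, (j < k)%N -> weak_derivative (D j) (D j.+1) &
        (total_variation 0 1 (D k) <= C%:E)%E].

End FunctionClass.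

Section TrendFiltering.
Context {R : realType}.

Definition diff1 (m : nat) : 'M[R]_(m.-1, m) :=
  \matrix_(i < m.-1, j < m)
    ((j == i.+1 :> nat)%:R - (j == i :> nat)%:R).

(* The k-th difference operator on R^n; its number of rows is n - k (truncated),
   written as k predecessors of n so that the recursion needs no cast. *)
Fixpoint diffop (n k : nat) : 'M[R]_(iter k predn n, n) :=
  match k with
  | 0%N => 1%:M
  | k'.+1 => diff1 (iter k' predn n) *m diffop n k'
  end.

Definition tf_objective (n k : nat) (lambda : R) (y beta : 'cV[R]_n) : R :=
  2^-1 * \sum_(i < n) (y i ord0 - beta i ord0) ^+ 2 +
  n%:R ^+ k / k`!%:R * lambda *
    \sum_(i < iter k.+1 predn n) `|(diffop n k.+1 *m beta) i ord0|.

(* [beta] is the argmin; it is unique as the objective is strictly convex. *)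
Definition is_trend_filter (n k : nat) (lambda : R) (y beta : 'cV[R]_n) : Prop :=
  forall b : 'cV[R]_n, tf_objective k lambda y beta <= tf_objective k lambda y b.

(* x_i = i / n for i = 1, ..., n; the ordinal [i : 'I_n] stands for i + 1. *)
Definition design (n : nat) (i : 'I_n) : R := i.+1%:R / n%:R.

Definition samples (n : nat) (f : R -> R) (e : 'I_n -> R) : 'cV[R]_n :=
  \col_i (f (design i) + e i).

Definition avg_sq_error (n : nat) (beta : 'cV[R]_n) (f : R -> R) : R :=
  n%:R^-1 * \sum_(i < n) (beta i ord0 - f (design i)) ^+ 2.

Definition minimax_rate (k n : nat) : R :=
  n%:R `^ (- ((2 * k + 2)%:R / (2 * k + 3)%:R)).

Definition theta (a b : nat -> R^o) : Prop := a =O_\oo b /\ b =O_\oo a.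

End TrendFiltering.

Section Noise.
Context {R : realType} {d : measure_display} {T : measurableType d}.
Variable P : probability T R.

Definition independent_RVs (I : finType) (X : I -> {RV P >-> R}) : Prop :=
  forall (J : {set I}) (A : I -> set R), (forall i, measurable (A i)) ->
    P (\bigcap_(i in [set` J]) (X i @^-1` A i)) =
    (\prod_(i in J) P (X i @^-1` A i))%E.

Definition identically_distributed (I : finType) (X : I -> {RV P >-> R}) : Prop :=
  forall (i j : I) (A : set R), measurable A ->
    distribution P (X i) A = distribution P (X j) A.

Definition iid (I : finType) (X : I -> {RV P >-> R}) : Prop :=
  independent_RVs X /\ identically_distributed X.

Definition sub_gaussian_tail (M sigma : R) (X : {RV P >-> R}) : Prop :=
  forall t : R, 0 < t ->
    (P [set w | (t < `|X w|)%R] <=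
      (M * expR (- (t ^+ 2 / (2 * sigma ^+ 2))))%:E)%E.

End Noise.

Section StochasticOrder.
Context {R : realType} {d : nat -> measure_display}
  {T : forall n, measurableType (d n)}.
Variable P : forall n, probability (T n) R.

(* A_n = O_P(B_n), for A_n defined on its own probability space P n. *)
Definition bigO_P (A : forall n, T n -> R) (B : nat -> R) : Prop :=
  forall eta : R, 0 < eta -> exists K : R,
    \forall n \near \oo,
      (P n [set w | (K < `|A n w / B n|)%R] <= eta%:E)%E.

Definition cvg0_P (A : forall n, T n -> R) : Prop :=
  forall delta : R, 0 < delta ->
    P n [set w | (delta < `|A n w|)%R] @[n --> \oo] --> 0%E.

End StochasticOrder.

(* Main.v *)
Require Import Defs.
From HB Require Import structures.
From mathcomp Require Import all_boot all_order all_algebra.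
From mathcomp Require Import finmap.
From mathcomp Require Import all_classical all_reals all_analysis.
From mathcomp Require Import measurable_realfun zify ring lra.
Import Order.TTheory GRing.Theory Num.Theory.
Import numFieldNormedType.Exports.
Local Open Scope classical_set_scope.
Local Open Scope ring_scope.

(** Write h for the difference between the estimate and f0 at the design
    points, e for the noise and |D h| for the l1 norm of the differences of order
    k + 1.  Optimality of the estimate, compared with the samples of f0, bounds
    |h|^2 / 2 by <e, h> plus the penalty of f0 minus the penalty of the estimate
    ([trend_filter_basic]).  Everything rests on a bound of <e, h> that holds for
    all h at once, with no logarithmic factor.

    That bound comes from a multiscale decomposition
    ([multiscale_decomposition]).  Cut the indices into cells of size 4^s and
    project orthogonally onto piecewise polynomials of degree at most k.  From a
    coarsest scale s0 down to single points, h telescopes into a sum of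
    coefficients times vectors of norm at most one.  At level r, which is scale
    s0 - r, the coefficients are bounded in l2 by |h| and, if r > 0, in l1 by
    |D h| times (2^(s0 - r))^(2k + 1) up to a constant; the second bound is a
    discrete Taylor expansion.  Each noise coefficient is cut at the threshold
    4 r.  The part below is paid with the l1 bound, and the thresholds grow slowly
    enough for the sum over r to converge.  The part above is paid with the l2
    bound, and e^(- 4 r) beats the 4^r cells of level r.  What remains is
    <e, h> <= 16 W + |h|^2 / 8 + c (2^s0)^(2k + 1) |D h|
    ([noise_inner_product_le]), where W is a weighted sum of exponentials of
    linear forms of norm at most one in the noise.  Their exponential moments are
    bounded ([linear_mgf]), so that the expectation of W is of the order of the
    number of cells at scale s0 ([expectation_noise_functional_le]).  As s0 is
    chosen without looking at the data, one application of Markov's inequality to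
    W replaces chaining.

    Put rho = n^(1/(2k + 3)), so that lambda is of order rho and the rate is
    rho / n.  For 2^s0 a small multiple of rho^(k + 1), the last term above is
    absorbed by the penalty of the estimate, whose level n^k lambda is of order
    (rho^(k + 1))^(2k + 1), and there are of the order of rho coarsest cells.
    Hence |h|^2 is at most a constant times W + rho n^k |D f0|, where |D f0| is
    taken at the samples of f0.

    The factor n^k |D f0| is bounded ([class_diff_sum_le]): tested against
    mollified B-splines, k differences of f0 become pairings with its k-th weak
    derivative, and the oscillations of the latter over windows of the grid add up
    to a multiple of its total variation.

    The estimate is an arbitrary selection of minimizers, so that the events whose
    probabilities are bounded have to be shown measurable.  They are because the
    minimizer is a Lipschitz function of the data ([measurable_error_event]). *)

(** * Finite differences and discrete Taylor expansion *)

Section Differences.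
Context {R : rcfType}.
Implicit Types (u v h p : nat -> R).

Definition fdiff u : nat -> R := fun i => u i.+1 - u i.

Lemma iter_fdiff_local m u v i :
  (forall j, (i <= j <= i + m)%N -> u j = v j) ->
  iter m fdiff u i = iter m fdiff v i.
Proof.
elim: m i => [|m IH] i uv /=; first by apply: uv; lia.
by rewrite /fdiff !IH// => j hj; apply: uv; lia.
Qed.

Lemma iter_fdiff_lin m (a : R) u v i :
  iter m fdiff (fun j => a * u j + v j) i
    = a * iter m fdiff u i + iter m fdiff v i.
Proof. by elim: m i => [//|m IH] i /=; rewrite /fdiff !IH; ring. Qed.

Lemma iter_fdiffB m u v i :
  iter m fdiff (fun j => u j - v j) i = iter m fdiff u i - iter m fdiff v i.
Proof. by elim: m i => [//|m IH] i /=; rewrite /fdiff !IH; ring. Qed.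

(** Sequences annihilated by K differences play the part of polynomials of degree
    less than K; Newton's formula shows that K binomial sequences span them. *)
Lemma newton_series K u : (forall i, iter K fdiff u i = 0) ->
  forall x, u x = \sum_(q < K) iter q fdiff u 0%N * 'C(x, q)%:R.
Proof.
elim: K u => [u u0 x|K IH u u0]; first by rewrite big_ord0; exact: (u0 x).
have Du y : fdiff u y = \sum_(q < K) iter q.+1 fdiff u 0%N * 'C(y, q)%:R.
  rewrite (IH (fdiff u)); last by move=> i; rewrite -iterSr u0.
  by apply: eq_bigr => q _; rewrite -iterSr.
elim=> [|x IHx].
  by rewrite big_ord_recl big1 ?addr0 ?bin0 ?mulr1// => q _; rewrite bin0n mulr0.
have -> : u x.+1 = u x + fdiff u x by rewrite /fdiff addrC subrK.
rewrite IHx Du !big_ord_recl !bin0 -addrA; congr (_ + _).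
rewrite -big_split /=; apply: eq_bigr => q _.
by rewrite /bump /= add1n binS natrD; ring.
Qed.

Lemma iter_fdiff_bin q K x : (q < K)%N ->
  iter K fdiff (fun i => 'C(i, q)%:R) x = 0 :> R.
Proof.
elim: q K x => [|q IH] [//|K] x qK; rewrite iterSr.
  suff -> : fdiff (fun i => 'C(i, 0)%:R) = (fun=> 0) :> (nat -> R).
    by elim: K {qK} x => [//|K IH] x /=; rewrite /fdiff !IH subrr.
  by apply/funext => i; rewrite /fdiff !bin0 subrr.
rewrite -[RHS](IH K x); last by lia.
congr (iter K fdiff _ x); apply/funext => i.
by rewrite /fdiff binS natrD addrAC subrr add0r.
Qed.

(** Induction on k: the polynomial that approximates the differences of h is summed
    from a on, and so is its error, over at most m indices. *)
Lemma discrete_taylor k a m h : exists p,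
  (forall i, iter k.+1 fdiff p i = 0) /\
  forall i, (a <= i < a + m)%N ->
    `|h i - p i| <= m%:R ^+ k *
      \sum_(a <= j < a + m - k.+1) `|iter k.+1 fdiff h j|.
Proof.
elim: k m h => [|k IH] m h.
  exists (fun=> h a); split=> [i|i ai]; first by rewrite /= /fdiff subrr.
  rewrite expr0 mul1r -(telescope_sumr h (n := a) (m := i)); last by lia.
  apply: (le_trans (ler_norm_sum _ _ _)) => /=.
  rewrite (@big_cat_nat _ _ _ i a (a + m - 1)%N) /=; [|lia|lia].
  by rewrite lerDl sumr_ge0.
have [p [p0 hp]] := IH m.-1 (fdiff h).
pose S x := \sum_(0 <= y < x) p y.
have Sa x y : (x <= y)%N -> S y - S x = \sum_(x <= z < y) p z.
  by move=> xy; rewrite /S (@big_cat_nat _ _ _ x 0%N y)//= addrAC subrr add0r.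
exists (fun x => h a + (S x - S a)); split=> [i|i ai].
  rewrite iterSr -[RHS](p0 i); congr (iter k.+1 fdiff _ i).
  by apply/funext => x; rewrite /fdiff /S big_nat_recr//=; ring.
rewrite opprD addrA -(telescope_sumr h (n := a) (m := i)); last by lia.
rewrite Sa; last by lia.
rewrite -sumrB; apply: (le_trans (ler_norm_sum _ _ _)).
set T := \sum_(_ <= j < _) `|iter k.+2 fdiff h j|.
have T0 : 0 <= T by rewrite sumr_ge0.
apply: (@le_trans _ _ (\sum_(a <= y < i) (m%:R ^+ k * T))).
  apply: ler_sum_nat => y hy.
  apply: (le_trans (hp y _)); first by lia.
  have -> : (\sum_(a <= j < a + m.-1 - k.+1) `|iter k.+1 fdiff (fdiff h) j|) = T.
    rewrite /T; rewrite (_ : a + m.-1 - k.+1 = a + m - k.+2)%N; last by lia.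
    by apply: eq_bigr => j _; rewrite (iterSr k.+1).
  by apply: ler_wpM2r => //; rewrite lerXn2r ?nnegrE ?ler0n// ler_nat leq_pred.
rewrite sumr_const_nat -[leLHS]mulr_natl exprS -[leRHS]mulrA; apply: ler_wpM2r.
  by rewrite mulr_ge0// exprn_ge0.
by rewrite ler_nat; lia.
Qed.

End Differences.

(** * Orthonormal systems of polynomial sequences *)

Section Projection.
Context {R : rcfType}.
Implicit Types (u v g h : nat -> R) (phi : nat -> nat -> R) (A : pred nat).

Definition dot n A u v : R := \sum_(i < n | A i) u i * v i.

Definition proj n A K phi u : nat -> R :=
  fun i => \sum_(q < K) dot n A u (phi q) * phi q i.

(** Zero vectors are admitted beside unit vectors: on a cell with fewer than K points
    the K polynomials below become dependent. *)
Definition orthosystem n A K phi := forall p q, (p < K)%N -> (q < K)%N ->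
  if p == q then dot n A (phi p) (phi p) = 1 \/ forall i, phi p i = 0
  else dot n A (phi p) (phi q) = 0.

Lemma dotC n A u v : dot n A u v = dot n A v u.
Proof. by apply: eq_bigr => i _; rewrite mulrC. Qed.

Lemma dotBl n A u v g : dot n A (fun i => u i - v i) g = dot n A u g - dot n A v g.
Proof. by rewrite -sumrB; apply: eq_bigr => i _; rewrite mulrBl. Qed.

Lemma dotZl n A a u g : dot n A (fun i => u i * a) g = dot n A u g * a.
Proof. by rewrite mulr_suml; apply: eq_bigr => i _; rewrite mulrAC. Qed.

Lemma dot_projl n A K phi u g :
  dot n A (proj n A K phi u) g =
  \sum_(q < K) dot n A u (phi q) * dot n A (phi q) g.
Proof.
rewrite /dot; under eq_bigr do rewrite /proj mulr_suml.
rewrite exchange_big /=; apply: eq_bigr => q _.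
by rewrite mulr_sumr; apply: eq_bigr => i _; rewrite mulrA.
Qed.

Lemma dot_ge0 n A u : 0 <= dot n A u u.
Proof. by apply: sumr_ge0 => i _; rewrite -expr2 sqr_ge0. Qed.

Lemma dot_eq0 n A u i : dot n A u u = 0 -> (i < n)%N -> A i -> u i = 0.
Proof.
move=> /eqP u0 hi Ai; move: u0; rewrite psumr_eq0; last first.
  by move=> j _; rewrite -expr2 sqr_ge0.
by move=> /allP /(_ (Ordinal hi) (mem_index_enum _)) /=; rewrite Ai -expr2 sqrf_eq0 => /eqP.
Qed.

Lemma eq_dot n A u v g : (forall i, (i < n)%N -> A i -> u i = v i) ->
  dot n A u g = dot n A v g.
Proof. by move=> uv; apply: eq_bigr => i Ai; rewrite uv. Qed.

Lemma dot_system n A K phi u (p q : 'I_K) : orthosystem n A K phi ->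
  dot n A u (phi p) * dot n A (phi p) (phi q) =
  if p == q then dot n A u (phi p) else 0.
Proof.
move=> os; have := os p q (ltn_ord p) (ltn_ord q).
rewrite -val_eqE /=; case: (altP (p =P q :> nat)) => [/val_inj <-|_].
  case=> [->|p0]; first by rewrite mulr1.
  suff -> : dot n A u (phi p) = 0 by rewrite mul0r.
  by apply: big1 => i _; rewrite p0 mulr0.
by move=> ->; rewrite mulr0.
Qed.

Lemma dot_sub_proj n A K phi u (q : 'I_K) : orthosystem n A K phi ->
  dot n A (fun i => u i - proj n A K phi u i) (phi q) = 0.
Proof.
move=> os; rewrite dotBl dot_projl.
under eq_bigr do rewrite dot_system//.
by rewrite -big_mkcond big_pred1_eq subrr.
Qed.

Lemma pythagoras n A K phi u : orthosystem n A K phi ->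
  dot n A (fun i => u i - proj n A K phi u i) (fun i => u i - proj n A K phi u i)
    = dot n A u u - \sum_(q < K) dot n A u (phi q) ^+ 2.
Proof.
move=> os; rewrite dotBl.
rewrite [X in _ - X](_ : _ = 0); last first.
  rewrite dot_projl big1// => q _.
  by rewrite [X in _ * X]dotC dot_sub_proj// mulr0.
rewrite subr0 dotC dotBl dot_projl; congr (_ - _).
by apply: eq_bigr => q _; rewrite expr2 [dot n A (phi q) u]dotC.
Qed.

Lemma bessel n A K phi u : orthosystem n A K phi ->
  \sum_(q < K) dot n A u (phi q) ^+ 2 <= dot n A u u.
Proof. by move=> os; rewrite -subr_ge0 -pythagoras// dot_ge0. Qed.

Lemma dot_sub_proj_le n A K phi u : orthosystem n A K phi ->
  dot n A (fun i => u i - proj n A K phi u i) (fun i => u i - proj n A K phi u i)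
    <= dot n A u u.
Proof.
by move=> os; rewrite pythagoras// gerBl sumr_ge0// => q _; exact: sqr_ge0.
Qed.

(** Inner products only see the values on A, whereas V constrains whole sequences: it
    keeps track of the linear space in which the new vectors are formed. *)
Lemma gram_schmidt (V : (nat -> R) -> Prop) n A K (v : nat -> nat -> R) :
  V (fun=> 0) ->
  (forall a f g, V f -> V g -> V (fun i => a * f i + g i)) ->
  (forall q, V (v q)) ->
  exists phi, [/\ orthosystem n A K phi, forall q, (q < K)%N -> V (phi q) &
    forall q i, (q < K)%N -> (i < n)%N -> A i ->
      proj n A K phi (v q) i = v q i].
Proof.
move=> V0 Vlin Vv; elim: K => [|K [phi [os Vphi rep]]]; first by exists (fun _ _ => 0).
pose r := fun i => v K i - proj n A K phi (v K) i.
have Vproj : V (proj n A K phi (v K)).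
  have : forall m, (m <= K)%N ->
      V (fun i => \sum_(q < m) dot n A (v K) (phi q) * phi q i).
    elim=> [_|m IH mK].
      by rewrite (_ : (fun=> _) = fun=> 0)//; apply/funext => i; rewrite big_ord0.
    have := Vlin (dot n A (v K) (phi m)) _ _ (Vphi m mK) (IH (ltnW mK)).
    by congr V; apply/funext => i; rewrite big_ord_recr /= addrC.
  exact.
have Vr : V r.
  have := Vlin (-1) _ _ Vproj (Vv K).
  by congr V; apply/funext => i; rewrite /r mulN1r addrC.
pose w : nat -> R := if dot n A r r == 0 then fun=> 0
   else fun i => r i * (Num.sqrt (dot n A r r))^-1.
have Vw : V w.
  rewrite /w; case: ifP => // _.
  have := Vlin (Num.sqrt (dot n A r r))^-1 _ _ Vr V0.
  by congr V; apply/funext => i; rewrite addr0 mulrC.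
have rq q : (q < K)%N -> dot n A r (phi q) = 0.
  by move=> qK; exact: (@dot_sub_proj n A K phi (v K) (Ordinal qK)).
have wq q : (q < K)%N -> dot n A w (phi q) = 0.
  move=> qK; rewrite /w; case: ifP => _; last by rewrite dotZl rq// mul0r.
  by apply: big1 => i _; rewrite mul0r.
have ww : dot n A w w = 1 \/ forall i, w i = 0.
  rewrite /w; case: ifP => [_|/negbT r0]; [by right|left].
  rewrite dotZl dotC dotZl -mulrA -invfM -expr2 sqr_sqrtr ?dot_ge0//.
  by rewrite divff.
have dw : r =1 (fun i => w i * Num.sqrt (dot n A r r)) \/ dot n A r r = 0.
  rewrite /w; case: ifP => [/eqP|/negbT r0]; [by right|left] => i.
  by rewrite mulfVK// sqrtr_eq0 -ltNge lt_def r0 dot_ge0.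
pose phi' q := if (q < K)%N then phi q else w.
exists phi'; split.
- move=> p q pK qK; rewrite /phi'.
  have [pK'|pK'] := ltnP p K; have [qK'|qK'] := ltnP q K.
  + by have := os p q pK' qK'.
  + have -> : (p == q) = false by apply/eqP; lia.
    by rewrite dotC wq.
  + have -> : (p == q) = false by apply/eqP; lia.
    by rewrite wq.
  + by have -> : (p == q) = true by apply/eqP; lia.
- by move=> q qK; rewrite /phi'; case: ltnP => // qK'; apply: Vphi.
move=> q i; rewrite ltnS leq_eqVlt => qK iN Ai.
have pE : proj n A K.+1 phi' (v q) i =
    proj n A K phi (v q) i + dot n A (v q) w * w i.
  rewrite /proj big_ord_recr /= /phi' ltnn; congr (_ + _).
  by apply: eq_bigr => j _; rewrite ltn_ord.
rewrite pE; case/predU1P: qK => [->|qK].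
  have vKw : dot n A (v K) w = dot n A r w.
    rewrite /r dotBl dot_projl big1 ?subr0// => j _.
    by rewrite [X in _ * X]dotC wq// mulr0.
  rewrite vKw addrC -[RHS](subrK (proj n A K phi (v K) i)); congr (_ + _).
  rewrite -/(r i); case: dw => [rw|r0].
    rewrite (eq_dot n A _ _ w (fun i _ _ => rw i)) dotZl rw.
    by case: ww => [->|w0]; [rewrite mul1r mulrC|rewrite !w0 mulr0 mul0r].
  by rewrite (@dot_eq0 n A r i r0)// /w r0 eqxx mulr0.
rewrite (rep q i qK iN Ai) (eq_dot n A _ (proj n A K phi (v q))); last first.
  by move=> j jn Aj; rewrite rep.
rewrite dot_projl big1 ?mul0r ?addr0// => j _.
by rewrite [X in _ * X]dotC wq// mulr0.
Qed.

(** The vectors are polynomial on all of nat, not only on A.  They remain so on any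
    smaller cell, which is how projections at two scales are compared. *)
Lemma polynomial_orthosystem n A K : exists phi,
  [/\ orthosystem n A K phi,
      forall q i, (q < K)%N -> iter K fdiff (phi q) i = 0 &
      forall p, (forall i, iter K fdiff p i = 0) ->
        forall i, (i < n)%N -> A i -> proj n A K phi p i = p i].
Proof.
have i0 i : iter K (@fdiff R) (fun=> 0) i = 0.
  by elim: K i => [//|K IH] i /=; rewrite /fdiff !IH subrr.
pose b q : nat -> R := if (q < K)%N then (fun i => 'C(i, q)%:R) else fun=> 0.
have := @gram_schmidt (fun u => forall i, iter K fdiff u i = 0) n A K b.
case=> [//|a f g f0 g0 i||phi [os V rep]].
- by rewrite iter_fdiff_lin f0 g0 mulr0 addr0.
- by move=> q i; rewrite /b; case: ifP => // qK; rewrite iter_fdiff_bin.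
exists phi; split=> // [q i qK|p p0 i iN Ai]; first exact: V.
have pE := @newton_series _ K p p0.
rewrite /proj [RHS]pE.
under eq_bigr => q _.
  rewrite (eq_dot n A p (fun x => \sum_(m < K) iter m fdiff p 0%N * 'C(x, m)%:R)).
    rewrite (_ : dot _ _ _ _ = \sum_(m < K) iter m fdiff p 0%N * dot n A (b m) (phi q)).
      rewrite mulr_suml. over.
    rewrite /dot; under eq_bigr do rewrite mulr_suml.
    rewrite exchange_big /=; apply: eq_bigr => m _.
    by rewrite mulr_sumr; apply: eq_bigr => j _; rewrite /b ltn_ord mulrA.
  by move=> j _ _; rewrite -pE.
rewrite exchange_big /=; apply: eq_bigr => m _.
under eq_bigr do rewrite -mulrA.
rewrite -mulr_sumr -/(proj n A K phi (b m) i) rep//.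
by rewrite /b ltn_ord.
Qed.

End Projection.

(** * Multiscale piecewise polynomial decomposition *)

Section Cells.
Context {R : rcfType}.
Implicit Types (e g h u F : nat -> R).

Definition cell (s l : nat) : pred nat := fun i => (i %/ 4 ^ s == l)%N.

Lemma fibre_sum n N (c : nat -> nat) F : (forall i, (i < n)%N -> (c i < N)%N) ->
  \sum_(i < n) F i = \sum_(l < N) \sum_(i < n | c i == l) F i.
Proof.
move=> cN; under [RHS]eq_bigr do rewrite big_mkcond.
rewrite exchange_big /=; apply: eq_bigr => i _.
by rewrite -big_mkcond (big_pred1 (Ordinal (cN i (ltn_ord i)))).
Qed.

Lemma cell_interval n b l F : (0 < b)%N ->
  \sum_(i < n | (i %/ b == l)%N) F i = \sum_(l * b <= i < minn (l.+1 * b) n) F i.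
Proof.
move=> b0.
rewrite -(big_mkord (fun i => i %/ b == l)%N F).
rewrite (@big_nat_widen _ _ _ _ (minn (l.+1 * b) n) n) ?geq_minr//.
rewrite (@big_nat_widenl _ _ _ (l * b)%N 0%N)//.
rewrite big_nat_cond [RHS]big_nat_cond; apply: eq_bigl => i.
have -> : (i %/ b == l)%N = (l * b <= i)%N && (i < l.+1 * b)%N.
  by rewrite eqn_leq -[(i %/ b <= l)%N]ltnS ltn_divLR// leq_divRL// andbC.
by rewrite /= leq_min; case: (i < n)%N; rewrite ?andbT//= andbC.
Qed.

Lemma le_sum_subrange a m m' F : (forall i, 0 <= F i) -> (m <= m')%N ->
  \sum_(a <= i < m) F i <= \sum_(a <= i < m') F i.
Proof.
move=> F0 mm; have [am|ma] := leqP a m.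
  by rewrite (@big_cat_nat _ _ _ m a m')//= lerDl sumr_ge0.
by rewrite big_geq ?(ltnW ma)// sumr_ge0.
Qed.

Variables (n k L : nat) (nL : (n <= 4 ^ L)%N).
Variable psi : nat -> nat -> nat -> nat -> R.
Hypothesis psi_os : forall s l, orthosystem n (cell s l) k.+1 (psi s l).
Hypothesis psi_poly : forall s l q i, (q < k.+1)%N ->
  iter k.+1 fdiff (psi s l q) i = 0.
Hypothesis psi_rep : forall s l p, (forall i, iter k.+1 fdiff p i = 0) ->
  forall i, (i < n)%N -> cell s l i ->
  proj n (cell s l) k.+1 (psi s l) p i = p i.

(** Orthogonal projection onto the sequences that are polynomial of degree at most k on
    each cell of size 4 ^ s. *)
Definition pwproj s g : nat -> R := fun i =>
  proj n (cell s (i %/ 4 ^ s)%N) k.+1 (psi s (i %/ 4 ^ s)%N) g i.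

Lemma pwproj_cell s l g i : cell s l i ->
  pwproj s g i = proj n (cell s l) k.+1 (psi s l) g i.
Proof. by move=> /eqP <-. Qed.

Lemma cell_lt s i : (s <= L)%N -> (i < n)%N -> (i %/ 4 ^ s < 4 ^ (L - s))%N.
Proof.
move=> sL i_n; rewrite ltn_divLR ?expn_gt0// -expnD subnK//.
exact: leq_trans nL.
Qed.

Lemma cell_sum s F : (s <= L)%N ->
  \sum_(i < n) F i = \sum_(l < 4 ^ (L - s)) \sum_(i < n | cell s l i) F i.
Proof. by move=> sL; apply: (fibre_sum n (4 ^ (L - s)) (fun i => i %/ 4 ^ s)%N) => i i_n; exact: cell_lt. Qed.

Lemma dot_pwproj s e g : (s <= L)%N ->
  \sum_(i < n) e i * pwproj s g i =
  \sum_(l < 4 ^ (L - s)) \sum_(q < k.+1)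
    dot n (cell s l) e (psi s l q) * dot n (cell s l) g (psi s l q).
Proof.
move=> sL; rewrite (cell_sum s (fun i => e i * pwproj s g i) sL).
apply: eq_bigr => l _.
under eq_bigr => i il do rewrite (pwproj_cell _ _ _ _ il) mulrC.
rewrite -[LHS]/(dot n (cell s l) (proj n (cell s l) k.+1 (psi s l) g) e).
by rewrite dot_projl; apply: eq_bigr => q _; rewrite [dot _ _ _ e]dotC mulrC.
Qed.

Lemma pwproj_bessel s g : (s <= L)%N ->
  \sum_(l < 4 ^ (L - s)) \sum_(q < k.+1) dot n (cell s l) g (psi s l q) ^+ 2
    <= \sum_(i < n) g i ^+ 2.
Proof.
move=> sL; rewrite (cell_sum s (fun i => g i ^+ 2) sL).
by apply: ler_sum => l _; exact: (bessel n (cell s l) k.+1 (psi s l) g).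
Qed.

Lemma pwproj_sub_le s g : (s <= L)%N ->
  \sum_(i < n) (g i - pwproj s g i) ^+ 2 <= \sum_(i < n) g i ^+ 2.
Proof.
move=> sL; rewrite (cell_sum s (fun i => (g i - pwproj s g i) ^+ 2) sL).
rewrite (cell_sum s (fun i => g i ^+ 2) sL).
apply: ler_sum => l _.
under eq_bigr => i il do rewrite (pwproj_cell _ _ _ _ il).
exact: (dot_sub_proj_le n (cell s l) k.+1 (psi s l) g).
Qed.

Lemma proj_ext (A : pred nat) phi u v i : (forall j, (j < n)%N -> A j -> u j = v j) ->
  proj n A k.+1 phi u i = proj n A k.+1 phi v i.
Proof. by move=> uv; apply: eq_bigr => q _; rewrite (eq_dot n A u v). Qed.

(** A cell of size one is a point, and on a point every sequence is constant. *)
Lemma pwproj0 g i : (i < n)%N -> pwproj 0 g i = g i.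
Proof.
move=> i_n; have ic : cell 0 i i by rewrite /cell expn0 divn1.
rewrite (pwproj_cell _ _ _ _ ic) (proj_ext _ _ g (fun=> g i)); last first.
  by move=> j _; rewrite /cell expn0 divn1 => /eqP ->.
rewrite psi_rep// => j.
rewrite iterSr (_ : fdiff _ = fun=> 0); last by apply/funext => x; rewrite /fdiff subrr.
by elim: (k) j => [//|m IH] j /=; rewrite /fdiff !IH subrr.
Qed.

Lemma cellS s l i : cell s l i -> cell s.+1 (l %/ 4)%N i.
Proof. by rewrite /cell expnSr divnMA => /eqP ->. Qed.

Lemma iter_fdiff_proj s l g i :
  iter k.+1 fdiff (proj n (cell s l) k.+1 (psi s l) g) i = 0.
Proof.
have : forall m, (m <= k.+1)%N -> iter k.+1 fdiff (fun i => \sum_(q < m)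
    dot n (cell s l) g (psi s l q) * psi s l q i) i = 0.
  elim=> [_|m IH mk].
    rewrite (_ : (fun=> _) = fun=> 0); last by apply/funext => j; rewrite big_ord0.
    by elim: (k.+1) i => [//|m IH] i /=; rewrite /fdiff !IH subrr.
  rewrite (_ : (fun=> _) = fun j => dot n (cell s l) g (psi s l m) * psi s l m j +
    \sum_(q < m) dot n (cell s l) g (psi s l q) * psi s l q j).
    by rewrite iter_fdiff_lin psi_poly// IH 1?ltnW// mulr0 addr0.
  by apply/funext => j; rewrite big_ord_recr addrC.
exact.
Qed.

(** A cell of size 4 ^ s lies inside one of size 4 ^ s.+1, so that what is piecewise
    polynomial for the coarse partition is so for the fine one. *)
Lemma pwproj_nested s g i : (i < n)%N ->
  pwproj s (pwproj s.+1 g) i = pwproj s.+1 g i.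
Proof.
move=> i_n; set l := (i %/ 4 ^ s)%N; have il : cell s l i by rewrite /cell.
rewrite (pwproj_cell _ _ _ _ il) (pwproj_cell _ _ _ _ (cellS _ _ _ il)).
rewrite -[RHS](psi_rep s l _ (iter_fdiff_proj _ _ _) i i_n il).
by apply: proj_ext => j _ jl; rewrite (pwproj_cell _ _ _ _ (cellS _ _ _ jl)).
Qed.

(** Level r lives at scale s0 - r.  Level 0 receives h itself, the next levels what the
    projection at the scale just above has left. *)
Definition residual s0 h r : nat -> R :=
  if r is r'.+1 then fun i => h i - pwproj (s0 - r') h i else h.

Lemma sum_pwproj_residual s0 h i : (i < n)%N ->
  \sum_(r < s0.+1) pwproj (s0 - r) (residual s0 h r) i = h i.
Proof.
move=> i_n; suff : forall r0, (r0 <= s0)%N ->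
    \sum_(r < r0.+1) pwproj (s0 - r) (residual s0 h r) i = pwproj (s0 - r0) h i.
  by move=> ->//; rewrite subnn pwproj0.
elim=> [_|r0 IH r0s]; first by rewrite big_ord_recl big_ord0 addr0.
rewrite big_ord_recr /= IH 1?ltnW//.
have E : (s0 - r0 = (s0 - r0.+1).+1)%N by lia.
rewrite -[pwproj (s0 - r0) h i]addr0 {1}E -(pwproj_nested _ _ _ i_n) -E addr0.
rewrite /pwproj /proj -big_split /=; apply: eq_bigr => q _.
by rewrite dotBl mulrBl addrC subrK.
Qed.

Definition cellTV s l h : R :=
  \sum_(j < n - k.+1 | cell s l j) `|iter k.+1 fdiff h j|.

(** The projection is the best approximation by a polynomial on the cell, hence at least
    as good as the Taylor polynomial of h. *)
Lemma sub_proj_le_TV s l h :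
  dot n (cell s l) (fun i => h i - pwproj s h i) (fun i => h i - pwproj s h i)
  <= ((2 ^+ s) ^+ (2 * k + 1) * cellTV s l h) ^+ 2.
Proof.
set b := (4 ^ s)%N; have b0 : (0 < b)%N by rewrite expn_gt0.
pose m := (minn (l.+1 * b) n - l * b)%N.
(* The last cell may be cut by n, hence the length m at most b. *)
have [p [p0 hp]] := discrete_taylor k (l * b) m h.
have T0 : 0 <= cellTV s l h by exact: sumr_ge0.
have hp' i : (i < n)%N -> cell s l i ->
    `|h i - p i| <= b%:R ^+ k * cellTV s l h.
  move=> i_n il; have ib : (l * b <= i < l.+1 * b)%N.
    move: il; rewrite /cell -/b => /eqP <-.
    by rewrite leq_divM ltn_ceil.
  apply: (le_trans (hp i _)); first by rewrite /m; lia.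
  have mb : (m <= b)%N by rewrite /m mulSn; lia.
  apply: ler_pM; rewrite ?exprn_ge0 ?sumr_ge0//.
    by rewrite lerXn2r ?nnegrE ?ler_nat.
  rewrite /cellTV (cell_interval (n - k.+1) b l (fun j => `|iter k.+1 fdiff h j|) b0).
  by apply: le_sum_subrange => //; rewrite /m; lia.
set g := fun i => h i - p i.
rewrite (_ : dot _ _ _ _ = dot n (cell s l)
  (fun i => g i - proj n (cell s l) k.+1 (psi s l) g i)
  (fun i => g i - proj n (cell s l) k.+1 (psi s l) g i)); last first.
  apply: eq_bigr => i il.
  suff -> : h i - pwproj s h i = g i - proj n (cell s l) k.+1 (psi s l) g i by [].
  rewrite (pwproj_cell _ _ _ _ il).
  have -> : proj n (cell s l) k.+1 (psi s l) g i =
      proj n (cell s l) k.+1 (psi s l) h i - proj n (cell s l) k.+1 (psi s l) p i.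
    by rewrite /proj -sumrB; apply: eq_bigr => q _; rewrite dotBl mulrBl.
  by rewrite (psi_rep _ _ _ p0)// /g opprB addrA addrNK.
apply: (le_trans (dot_sub_proj_le _ _ _ _ _ (psi_os s l))).
apply: (@le_trans _ _ (\sum_(i < n | cell s l i) (b%:R ^+ k * cellTV s l h) ^+ 2)).
  apply: ler_sum => i il; rewrite -expr2 -real_normK ?num_real//.
  by rewrite lerXn2r ?nnegrE ?normr_ge0 ?mulr_ge0 ?exprn_ge0 ?hp'.
rewrite (cell_interval n b l (fun=> _) b0) sumr_const_nat.
(* b points, each with squared error (b ^ k V) ^ 2: this is (2 ^ s) ^ (2 (2 k + 1)) V ^ 2. *)
have bE : b%:R = (2 ^+ s) ^+ 2 :> R by rewrite /b -exprM mulnC exprM -!natrX.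
apply: (@le_trans _ _ ((b%:R ^+ k * cellTV s l h) ^+ 2 *+ b)).
  apply: ler_wpMn2l; first exact: sqr_ge0.
  by rewrite mulSn; lia.
rewrite -[leLHS]mulr_natl bE !(exprMn 2 _ (cellTV s l h)) mulrA; apply: ler_wpM2r; first exact: sqr_ge0.
have E (x : R) : x ^+ 2 * (x ^+ 2) ^+ k ^+ 2 = (x ^+ (2 * k + 1)) ^+ 2.
  by rewrite -!(exprM x) -(exprD x); congr (x ^+ _); lia.
by rewrite E.
Qed.

(** A coefficient is at most the norm of the residual on its cell (Bessel), hence at most
    its norm on the parent cell l %/ 4, from which the polynomial part was removed. *)
Lemma coef_le_cellTV s l q h : (q < k.+1)%N ->
  `|dot n (cell s l) (fun i => h i - pwproj s.+1 h i) (psi s l q)|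
  <= (2 ^+ s.+1) ^+ (2 * k + 1) * cellTV s.+1 (l %/ 4)%N h.
Proof.
move=> qk; set g := fun i => _.
have B0 : 0 <= (2 ^+ s.+1) ^+ (2 * k + 1) * cellTV s.+1 (l %/ 4)%N h.
  by rewrite mulr_ge0 ?exprn_ge0//; exact: sumr_ge0.
rewrite -ler_sqr ?nnegrE ?normr_ge0// real_normK ?num_real//.
apply: le_trans (sub_proj_le_TV _ _ _); rewrite -/g.
apply: (@le_trans _ _ (dot n (cell s l) g g)).
  apply: le_trans (bessel _ _ _ _ g (psi_os s l)).
  rewrite (bigD1 (Ordinal qk))//= lerDl sumr_ge0// => i _; exact: sqr_ge0.
rewrite /dot [leLHS]big_mkcond [leRHS]big_mkcond /=.
apply: ler_sum => i _; case: ifPn => [il|_]; first by rewrite (cellS _ _ _ il).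
by case: ifP => // _; rewrite -expr2 sqr_ge0.
Qed.

(** The factor 4 counts the children of a cell. *)
Lemma sum_coef_le s h : (s < L)%N ->
  \sum_(l < 4 ^ (L - s)) \sum_(q < k.+1)
    `|dot n (cell s l) (fun i => h i - pwproj s.+1 h i) (psi s l q)|
  <= 4 * k.+1%:R * (2 ^+ s.+1) ^+ (2 * k + 1) *
     \sum_(j < n - k.+1) `|iter k.+1 fdiff h j|.
Proof.
move=> sL; set B := (2 ^+ s.+1) ^+ _.
have B0 : 0 <= B by rewrite !exprn_ge0.
pose N := (4 ^ (L - s.+1))%N.
have NE : (4 ^ (L - s) = N * 4)%N by rewrite /N -expnSr; congr (_ ^ _)%N; lia.
have T0 l : 0 <= cellTV s.+1 l h by exact: sumr_ge0.
apply: (@le_trans _ _ (\sum_(l < 4 ^ (L - s)) k.+1%:R * B * cellTV s.+1 (l %/ 4)%N h)).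
  apply: ler_sum => l _.
  apply: (@le_trans _ _ (\sum_(q < k.+1) B * cellTV s.+1 (l %/ 4)%N h)).
    by apply: ler_sum => q _; exact: coef_le_cellTV.
  by rewrite sumr_const card_ord -[leLHS]mulr_natl mulrA.
rewrite -mulr_sumr -[leRHS]mulrA [4 * _]mulrC -!mulrA ler_wpM2l//.
rewrite mulrCA ler_wpM2l// NE.
rewrite (fibre_sum (N * 4) N (fun l => l %/ 4)%N (fun l => cellTV s.+1 (l %/ 4)%N h));
  last by move=> i; rewrite ltn_divLR.
have -> : \sum_(j < n - k.+1) `|iter k.+1 fdiff h j| = \sum_(l < N) cellTV s.+1 l h.
  apply: (fibre_sum _ N (fun j => j %/ 4 ^ s.+1)%N (fun j => `|iter k.+1 fdiff h j|)).
  by move=> j jn; apply: cell_lt => //; apply: leq_trans jn _; exact: leq_subr.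
rewrite mulr_sumr; apply: ler_sum => l _.
rewrite (eq_bigr (fun=> cellTV s.+1 l h)); last by move=> j /eqP ->.
rewrite (cell_interval (N * 4) 4 l (fun=> cellTV s.+1 l h))// sumr_const_nat.
by rewrite mulr_natl ler_wpMn2l//; lia.
Qed.

End Cells.

(** The l2 and the l1 bound of a level are both needed: the l2 bound alone does not see
    the smoothness of h, and the l1 bound alone would have to be paired with the maximum
    of the noise coefficients, at the cost of a logarithmic factor. *)
Lemma multiscale_decomposition (R : rcfType) n k L s0 :
  (n <= 4 ^ L)%N -> (s0 <= L)%N ->
  exists (phi : nat -> nat -> nat -> nat -> R)
         (theta : (nat -> R) -> nat -> nat -> nat -> R),
  [/\ forall r l q, (q < k.+1)%N -> \sum_(i < n) phi r l q i ^+ 2 <= 1,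
      forall e h : nat -> R, \sum_(i < n) e i * h i =
        \sum_(r < s0.+1) \sum_(l < 4 ^ (L - s0 + r)) \sum_(q < k.+1)
          (\sum_(i < n) e i * phi r l q i) * theta h r l q,
      forall h r, (r <= s0)%N ->
        \sum_(l < 4 ^ (L - s0 + r)) \sum_(q < k.+1) theta h r l q ^+ 2
          <= \sum_(i < n) h i ^+ 2 &
      forall h r, (r < s0)%N ->
        \sum_(l < 4 ^ (L - s0 + r.+1)) \sum_(q < k.+1) `|theta h r.+1 l q|
          <= 4 * k.+1%:R * (2 ^+ (s0 - r)) ^+ (2 * k + 1) *
             \sum_(j < n - k.+1) `|iter k.+1 fdiff h j| ].
Proof.
move=> nL s0L.
have /choice[psi hpsi] : forall sl : nat * nat, exists phi,
  [/\ orthosystem n (cell sl.1 sl.2) k.+1 phi,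
      forall q i, (q < k.+1)%N -> iter k.+1 fdiff (phi q) i = 0 :> R &
      forall p, (forall i, iter k.+1 fdiff p i = 0) ->
        forall i, (i < n)%N -> cell sl.1 sl.2 i ->
          proj n (cell sl.1 sl.2) k.+1 phi p i = p i].
  by move=> [s l]; exact: polynomial_orthosystem.
pose psi' s l := psi (s, l).
have os s l : orthosystem n (cell s l) k.+1 (psi' s l) by case: (hpsi (s, l)).
have poly s l q i : (q < k.+1)%N -> iter k.+1 fdiff (psi' s l q) i = 0.
  by case: (hpsi (s, l)) => _ + _; exact.
have rep s l p : (forall i, iter k.+1 fdiff p i = 0) ->
    forall i, (i < n)%N -> cell s l i -> proj n (cell s l) k.+1 (psi' s l) p i = p i.
  by case: (hpsi (s, l)) => _ _; exact.
pose res := residual n k psi' s0.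
have lvl r : (r <= s0)%N -> (L - s0 + r = L - (s0 - r))%N by lia.
exists (fun r l q i => if cell (s0 - r) l i then psi' (s0 - r)%N l q i else 0).
exists (fun h r l q => dot n (cell (s0 - r) l) (res h r) (psi' (s0 - r)%N l q)).
split=> [r l q qk|e h|h r rs|h r rs].
- apply: (@le_trans _ _ (dot n (cell (s0 - r) l) (psi' (s0 - r)%N l q)
      (psi' (s0 - r)%N l q))).
    rewrite /dot [leRHS]big_mkcond; apply: ler_sum => i _.
    by case: ifP; rewrite ?expr2 ?mulr0.
  have := os (s0 - r)%N l q q qk qk; rewrite eqxx => -[-> //|p0].
  by rewrite /dot big1// => i _; rewrite p0 mulr0.
- under eq_bigr => i _ do rewrite -(sum_pwproj_residual n k L nL psi' poly rep s0 h i (ltn_ord i)) mulr_sumr.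
  rewrite exchange_big; apply: eq_bigr => r _ /=.
  have rs : (r <= s0)%N by rewrite -ltnS.
  rewrite (dot_pwproj n k L nL); last by lia.
  rewrite lvl//; apply: eq_bigr => l _; apply: eq_bigr => q _.
  congr (_ * _); rewrite /dot big_mkcond; apply: eq_bigr => i _.
  by case: ifP; rewrite ?mulr0.
- rewrite lvl//; apply: (@le_trans _ _ (\sum_(i < n) res h r i ^+ 2)).
    by apply: (pwproj_bessel n k L nL psi' os); lia.
  case: r {rs} => [//|r]; apply: (pwproj_sub_le n k L nL psi' os); lia.
- rewrite lvl//.
  have E : (s0 - r = (s0 - r.+1).+1)%N by lia.
  rewrite /res /= E; apply: (sum_coef_le n k L nL psi' os rep); lia.
Qed.

(** * Inner product with the noise *)

Section NoiseBound.
Context {R : realType}.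

(** Below the threshold t the product costs t times |c|.  The excess u = |x| - t is
    separated from c by Young's inequality with parameter a, and its square is dominated
    by e^u <= e^(- t) (e^x + e^(- x)). *)
Lemma thresholded_young (a t x c : R) : 0 < a -> 0 <= t ->
  x * c <= t * `|c| + 16 * a * expR (- t) * (expR x + expR (- x))
           + c ^+ 2 / (16 * a).
Proof.
move=> a0 t0.
have e0 : 0 < expR (- t) * (expR x + expR (- x)).
  by rewrite mulr_gt0 ?addr_gt0 ?expR_gt0.
apply: (@le_trans _ _ (`|x| * `|c|)); first by rewrite -normrM ler_norm.
have c2 : `|c| ^+ 2 = c ^+ 2 by rewrite real_normK ?num_real.
rewrite -c2; move: {c2} `|c| (normr_ge0 c) => {}c c0.
have q0 : 0 <= c ^+ 2 / (16 * a) by rewrite divr_ge0 ?sqr_ge0 ?mulr_ge0 ?ltW.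
have [xt|tx] := leP `|x| t.
  rewrite -addrA; apply: (@le_trans _ _ (t * c)); first exact: ler_wpM2r.
  by rewrite lerDl addr_ge0// -mulrA !mulr_ge0// ltW.
pose u := `|x| - t.
have u0 : 0 < u by rewrite subr_gt0.
have -> : `|x| * c = t * c + u * c by rewrite /u; ring.
rewrite -addrA lerD2l.
have eu : expR u <= expR (- t) * (expR x + expR (- x)).
  rewrite /u expRD mulrC ler_pM2l ?expR_gt0//.
  case: (ger0P x) => _; first by rewrite lerDl expR_ge0.
  by rewrite lerDr expR_ge0.
have u2 : u ^+ 2 / 4 <= expR u.
  have -> : expR u = expR (u / 2) ^+ 2.
    by rewrite expr2 -expRD; congr expR; field.
  have h : u / 2 <= expR (u / 2) by have := expR_ge1Dx (u / 2); lra.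
  have : 0 <= u / 2 by lra.
  by nra.
(* Young's inequality for the excess u over the threshold. *)
have amgm : u * c <= 4 * a * u ^+ 2 + c ^+ 2 / (16 * a).
  have a1 : a != 0 by rewrite gt_eqF.
  have -> : 4 * a * u ^+ 2 + c ^+ 2 / (16 * a) =
     u * c + (8 * a * u - c) ^+ 2 / (16 * a) by field.
  by rewrite lerDl divr_ge0 ?sqr_ge0// mulr_ge0// ltW.
apply: (le_trans amgm); rewrite lerD2r.
have -> : 4 * a * u ^+ 2 = 16 * a * (u ^+ 2 / 4) by field.
rewrite -(mulrA (16 * a)); apply: ler_wpM2l; last exact: le_trans eu.
by rewrite mulr_ge0// ltW.
Qed.

Lemma sum_geo2_le m : \sum_(r < m) (2 ^- r : R) <= 2.
Proof.
suff -> : \sum_(r < m) (2 ^- r : R) = 2 - 2 / 2 ^+ m.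
  by rewrite gerBl divr_ge0 ?exprn_ge0.
elim: m => [|m IH]; first by rewrite big_ord0 expr0 divr1 subrr.
rewrite big_ord_recr /= IH exprS; field.
by rewrite expf_neq0.
Qed.

Lemma sum_arith_geo2_le m : \sum_(r < m) (r.+1%:R / 2 ^+ r : R) <= 4.
Proof.
suff -> : \sum_(r < m) (r.+1%:R / 2 ^+ r : R) = 4 - (2 * m%:R + 4) / 2 ^+ m.
  by rewrite gerBl divr_ge0 ?exprn_ge0// addr_ge0// mulr_ge0.
elim: m => [|m IH]; first by rewrite big_ord0 expr0; field.
rewrite big_ord_recr /= IH exprS -natr1; field.
by rewrite expf_neq0.
Qed.

(** The weight of level r combines the Young parameter 2 ^ r with the threshold 4 r.  N0 is
    the number of cells at the coarsest scale, so that N0 * 4 ^ r is that of level r. *)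
Definition noise_functional n K N0 s0 (phi : nat -> nat -> nat -> nat -> R)
    (e : nat -> R) : R :=
  \sum_(r < s0.+1) 2 ^+ r * expR (- (4 * r%:R)) *
    \sum_(l < N0 * 4 ^ r) \sum_(q < K)
      (expR (\sum_(i < n) e i * phi r l q i)
       + expR (- \sum_(i < n) e i * phi r l q i)).

(** [thresholded_young] at level r with parameter 2 ^ r and threshold 4 r.  The l2 parts
    sum to at most |h|^2 / 8 by the geometric series of the 2 ^- r.  The l1 bounds decrease
    at least like 2 ^- r, so that their sum against the thresholds converges. *)
Lemma noise_inner_product_le n k L s0 : (n <= 4 ^ L)%N -> (s0 <= L)%N ->
  exists phi : nat -> nat -> nat -> nat -> R,
    (forall r l q, (q < k.+1)%N -> \sum_(i < n) phi r l q i ^+ 2 <= 1) /\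
    forall e h : nat -> R, \sum_(i < n) e i * h i <=
      16 * noise_functional n k.+1 (4 ^ (L - s0)) s0 phi e
      + (\sum_(i < n) h i ^+ 2) / 8
      + 64 * k.+1%:R * (2 ^+ s0) ^+ (2 * k + 1) *
         \sum_(j < n - k.+1) `|iter k.+1 fdiff h j|.
Proof.
move=> nL s0L.
have [phi [theta [unit_phi dec th2 th1]]] := multiscale_decomposition R n k L s0 nL s0L.
exists phi; split=> // e h; rewrite dec.
set S := \sum_(j < n - k.+1) _.
have S0 : 0 <= S by exact: sumr_ge0.
pose X r l q := \sum_(i < n) e i * phi r l q i.
pose A r := \sum_(l < 4 ^ (L - s0) * 4 ^ r) \sum_(q < k.+1)
   (expR (X r l q) + expR (- X r l q)).
pose H := \sum_(i < n) h i ^+ 2.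
have H0 : 0 <= H by apply: sumr_ge0 => i _; exact: sqr_ge0.
pose T r := \sum_(l < 4 ^ (L - s0 + r)) \sum_(q < k.+1) `|theta h r l q|.
have step (r : nat) : (r <= s0)%N ->
  \sum_(l < 4 ^ (L - s0 + r)) \sum_(q < k.+1) X r l q * theta h r l q
  <= 4 * r%:R * T r
   + 16 * (2 ^+ r * expR (- (4 * r%:R)) * A r) + H / 16 * 2 ^- r.
  move=> rs.
  have a0 : 0 < 2 ^+ r :> R by rewrite exprn_gt0.
  apply: (@le_trans _ _ (\sum_(l < 4 ^ (L - s0 + r)) \sum_(q < k.+1)
     ((4 * r%:R) * `|theta h r l q| + 16 * 2 ^+ r * expR (- (4 * r%:R)) *
        (expR (X r l q) + expR (- X r l q)) +
      theta h r l q ^+ 2 / (16 * 2 ^+ r)))).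
    apply: ler_sum => l _; apply: ler_sum => q _.
    by apply: thresholded_young => //; rewrite mulr_ge0.
  under eq_bigr do rewrite big_split big_split /= -!mulr_sumr -mulr_suml.
  rewrite big_split big_split /= -!mulr_sumr -mulr_suml.
  rewrite /A -expnD; apply: lerD; last first.
    rewrite invfM mulrA; apply: ler_wpM2r; first by rewrite invr_ge0 ltW.
    by apply: ler_wpM2r => //; exact: th2.
  by rewrite -!mulrA.
apply: (@le_trans _ _ (\sum_(r < s0.+1) (4 * r%:R * T r
   + 16 * (2 ^+ r * expR (- (4 * r%:R)) * A r) + H / 16 * 2 ^- r))).
  by apply: ler_sum => r _; apply: step; rewrite -ltnS.
rewrite big_split big_split /= -!mulr_sumr.
rewrite -/(noise_functional n k.+1 (4 ^ (L - s0)) s0 phi e).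
rewrite -addrA addrC; apply: lerD; first apply: lerD => //.
  have -> : H / 8 = H / 16 * 2 by field.
  apply: ler_wpM2l; first by rewrite divr_ge0.
  exact: sum_geo2_le.
(* Level 0 has threshold 0: no l1 bound is available there. *)
rewrite big_ord_recl mulr0 mul0r add0r.
apply: (@le_trans _ _ (\sum_(r < s0)
   (16 * k.+1%:R * (2 ^+ s0) ^+ (2 * k + 1) * S) * (r.+1%:R / 2 ^+ r))).
  apply: ler_sum => r _; rewrite [nat_of_ord (lift _ _)]lift0.
  have := th1 h r (ltn_ord r); rewrite -/(T r.+1) -/S => hT.
  apply: (@le_trans _ _ (4 * r.+1%:R * (4 * k.+1%:R *
     ((2 ^+ s0) ^+ (2 * k + 1) / 2 ^+ r) * S))).
    apply: ler_wpM2l; first by rewrite mulr_ge0.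
    apply: (le_trans hT); apply: ler_wpM2r => //; apply: ler_wpM2l.
      by rewrite mulr_ge0.
    rewrite ler_pdivlMr ?exprn_gt0//.
    have -> : 2 ^+ s0 = 2 ^+ (s0 - r) * 2 ^+ r :> R.
      by rewrite -exprD subnK// ltnW.
    rewrite exprMn; apply: ler_wpM2l; first by rewrite !exprn_ge0.
    rewrite addn1 exprS ler_peMr ?exprn_ge0//.
    by rewrite exprn_ege1// exprn_ege1// ler1n.
  rewrite le_eqVlt; apply/orP; left; apply/eqP; ring.
rewrite -mulr_sumr.
apply: (@le_trans _ _ (16 * k.+1%:R * (2 ^+ s0) ^+ (2 * k + 1) * S * 4)).
  apply: ler_wpM2l; first by rewrite !mulr_ge0 ?exprn_ge0.
  exact: sum_arith_geo2_le.
by rewrite le_eqVlt; apply/orP; left; apply/eqP; ring.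
Qed.

End NoiseBound.

(** * The trend filtering problem *)

Section TrendFilter.
Context {R : realType}.

(** Turns a vector into a sequence, on which differences of all orders are taken without
    any dimension; the values from n on never enter those of index below n - k. *)
Definition extend {n} (b : 'cV[R]_n) : nat -> R :=
  fun i => if insub i is Some j then b j ord0 else 0.

Lemma extend_ord n (b : 'cV[R]_n) (i : 'I_n) : extend b i = b i ord0.
Proof. by rewrite /extend valK. Qed.

Lemma iter_predn k n : iter k predn n = (n - k)%N.
Proof. by elim: k => [|k IH] /=; [rewrite subn0|rewrite IH subnS]. Qed.

Lemma diff1_mul m (v : 'cV[R]_m) (i : 'I_m.-1) (j j' : 'I_m) :
  j = i :> nat -> j' = i.+1 :> nat ->
  (diff1 m *m v) i ord0 = v j' ord0 - v j ord0.
Proof.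
move=> ji j'i; rewrite mxE.
under eq_bigr do rewrite mxE mulrBl.
rewrite sumrB; congr (_ - _).
  rewrite (bigD1 j')//= j'i eqxx mul1r big1 ?addr0// => l lj.
  by rewrite -j'i val_eqE (negbTE lj) mul0r.
rewrite (bigD1 j)//= ji eqxx mul1r big1 ?addr0// => l lj.
by rewrite -ji val_eqE (negbTE lj) mul0r.
Qed.

Lemma diffop_fdiff n k (b : 'cV[R]_n) (i : 'I_(iter k predn n)) :
  (diffop n k *m b) i ord0 = iter k fdiff (extend b) i.
Proof.
elim: k i => [|k IH] i; first by rewrite mul1mx /= extend_ord.
have hi : (i.+1 < iter k predn n)%N by have := ltn_ord i; rewrite /=; lia.
rewrite /= -mulmxA (diff1_mul _ _ _ (Ordinal (ltnW hi)) (Ordinal hi))//.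
by rewrite !IH.
Qed.

Lemma sum_diffop n k (b : 'cV[R]_n) :
  \sum_(i < iter k.+1 predn n) `|(diffop n k.+1 *m b) i ord0| =
  \sum_(j < n - k.+1) `|iter k.+1 fdiff (extend b) j|.
Proof.
under eq_bigr do rewrite diffop_fdiff.
rewrite -(big_mkord xpredT (fun j => `|iter k.+1 fdiff (extend b) j|)).
by rewrite iter_predn big_mkord.
Qed.

(** The objective at b is compared with its value at the samples of f.  As B is at most
    the penalty level, the share of b in the differences of b - f is absorbed by the
    penalty of b. *)
Lemma trend_filter_basic n k (lambda : R) (f : R -> R) (e : 'I_n -> R)
    (b : 'cV[R]_n) (B W : R) :
  is_trend_filter k lambda (samples f e) b ->
  B <= n%:R ^+ k / k`!%:R * lambda ->
  (forall h : 'cV[R]_n, \sum_(i < n) e i * h i ord0 <=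
     W + (\sum_(i < n) h i ord0 ^+ 2) / 8
     + B * \sum_(j < n - k.+1) `|iter k.+1 fdiff (extend h) j|) ->
  0 <= B ->
  \sum_(i < n) (b i ord0 - f (design i)) ^+ 2 <=
    8 / 3 * (W + 2 * (n%:R ^+ k / k`!%:R * lambda) *
    \sum_(j < n - k.+1) `|iter k.+1 fdiff (fun i => f (i.+1%:R / n%:R)) j|).
Proof.
move=> tf; set La := _ * lambda => BL hW B0.
pose g : 'cV[R]_n := samples f (fun=> 0).
have gE i : g i ord0 = f (design i) by rewrite mxE addr0.
have := tf g; rewrite /tf_objective -/La !sum_diffop.
set Sb := \sum_(j < _) `|iter _ _ (extend b) _|.
set Sg := \sum_(j < _) `|iter _ _ (extend g) _|.
have <- : Sg = \sum_(j < n - k.+1)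
    `|iter k.+1 fdiff (fun i => f (i.+1%:R / n%:R)) j|.
  apply: eq_bigr => j _; congr `|_|; apply: iter_fdiff_local => l jl.
  have l_n : (l < n)%N by have := ltn_ord j; lia.
  by rewrite -[l]/(val (Ordinal l_n)) extend_ord gE.
have := hW (b - g).
set S := \sum_(j < _) `|iter _ _ (extend (b - g)) _|.
have SE : S <= Sb + Sg.
  rewrite -big_split; apply: ler_sum => j _.
  have E : iter k.+1 fdiff (extend (b - g)) j =
     iter k.+1 fdiff (extend b) j - iter k.+1 fdiff (extend g) j.
    rewrite -iter_fdiffB; apply: iter_fdiff_local => l jl.
    have l_n : (l < n)%N by have := ltn_ord j; lia.
    by rewrite -[l]/(val (Ordinal l_n)) !extend_ord !mxE.
  by rewrite E; exact: ler_normB.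
have Sb0 : 0 <= Sb by exact: sumr_ge0.
have Sg0 : 0 <= Sg by exact: sumr_ge0.
have -> : \sum_(i < n) (b i ord0 - f (design i)) ^+ 2 =
    \sum_(i < n) (b - g) i ord0 ^+ 2.
  by apply: eq_bigr => i _; rewrite -gE !mxE.
set H := \sum_(i < n) (b - g) i ord0 ^+ 2.
set X := \sum_(i < n) e i * (b - g) i ord0.
have -> : \sum_(i < n) (samples f e i ord0 - b i ord0) ^+ 2 =
    \sum_(i < n) e i ^+ 2 - 2 * X + H.
  rewrite mulr_sumr -sumrB -big_split; apply: eq_bigr => i _ /=.
  by rewrite !mxE; ring.
have -> : \sum_(i < n) (samples f e i ord0 - g i ord0) ^+ 2 = \sum_(i < n) e i ^+ 2.
  by apply: eq_bigr => i _; rewrite !mxE; ring.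
set E := \sum_(i < n) _ => hX.
have BS : B * S <= La * (Sb + Sg).
  apply: (@le_trans _ _ (B * (Sb + Sg))); first exact: ler_wpM2l.
  by apply: ler_wpM2r => //; exact: addr_ge0.
rewrite mulrDr in BS *; move: hX BS; nra.
Qed.

(** Strong convexity, through the midpoint m of b and b': when the optimality of b and b'
    against m are added, convexity makes the penalties cancel. *)
Lemma trend_filter_lipschitz n k (lambda : R) (y y' b b' : 'cV[R]_n) :
  0 <= lambda ->
  is_trend_filter k lambda y b -> is_trend_filter k lambda y' b' ->
  \sum_(i < n) (b' i ord0 - b i ord0) ^+ 2 <=
  4 * \sum_(i < n) (y' i ord0 - y i ord0) ^+ 2.
Proof.
move=> l0 tf tf'; pose m := 2^-1 *: (b + b').
have := lerD (tf m) (tf' m); rewrite /tf_objective.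
set La := _ * lambda.
have La0 : 0 <= La by rewrite mulr_ge0// divr_ge0// exprn_ge0.
set Pb := \sum_(i < _) `|(_ *m b) i _|.
set Pb' := \sum_(i < _) `|(_ *m b') i _|.
set Pm := \sum_(i < _) `|(_ *m m) i _|.
have Pconv : Pm <= 2^-1 * (Pb + Pb').
  rewrite -big_split mulr_sumr; apply: ler_sum => i _ /=.
  rewrite -scalemxAr mxE normrM ger0_norm//.
  by apply: ler_wpM2l => //; rewrite mulmxDr mxE ler_normD.
have LaP : La * Pm <= La * (2^-1 * (Pb + Pb')) by exact: ler_wpM2l.
set D := \sum_(i < n) (b' i ord0 - b i ord0) ^+ 2.
set Y := \sum_(i < n) (y' i ord0 - y i ord0) ^+ 2.
set A1 := \sum_(i < n) _; set A2 := \sum_(i < n) (_ - m _ _) ^+ 2.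
set A3 := \sum_(i < n) _; set A4 := \sum_(i < n) (_ - m _ _) ^+ 2.
move=> h; have hA : A1 + A3 <= A2 + A4 by nra.
suff : D / 4 - Y <= A1 + A3 - (A2 + A4) by lra.
rewrite /D mulr_suml /Y /A1 /A2 /A3 /A4 -!big_split -!sumrB /=.
apply: ler_sum => i _; rewrite !mxE.
rewrite -subr_ge0; set z := (X in 0 <= X).
suff -> : z = ((b' i ord0 - b i ord0) / 2 - (y' i ord0 - y i ord0)) ^+ 2
  by exact: sqr_ge0.
by rewrite /z; field.
Qed.

End TrendFilter.

(** * Conditions open in finitely many measurable variables *)

Section Measurability.
Context {R : realType} {d : measure_display} {T : measurableType d}.

(** No function of X is assumed to define G: every point of G only has to own a
    neighbourhood in the X-variables inside G.  The boxes with rational center and inverse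
    integer radius whose preimage lies in G then cover G. *)
Lemma measurable_open_condition n (X : 'I_n -> T -> R) (G : set T) :
  (forall i, measurable_fun setT (X i)) ->
  (forall w, G w -> exists2 e : R, 0 < e &
     forall w', (forall i, `|X i w' - X i w| < e) -> G w') ->
  measurable G.
Proof.
move=> mX hG.
pose O (qm : {ffun 'I_n -> rat} * nat) : set T :=
  \bigcap_(i in [set: 'I_n]) (X i @^-1` ball (ratr (qm.1 i) : R) (qm.2.+1%:R^-1)).
pose O' qm := if `[< O qm `<=` G >] then O qm else set0.
suff -> : G = \bigcup_qm O' qm.
  apply: countable_bigcupT_measurable => // -[q m].
  rewrite /O'; case: ifP => // _.
  rewrite /O; apply: fin_bigcap_measurable => // i _.
  rewrite -[X in measurable X]setTI; apply: mX => //.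
  exact: measurable_ball.
apply/seteqP; split=> [w Gw|w [qm _]]; last first.
  by rewrite /O'; case: ifP => // /asboolP; exact.
have [e e0 he] := hG w Gw.
have [m hm] : exists m : nat, m.+1%:R^-1 < e / 2.
  have e20 : 0 < (e / 2) by rewrite divr_gt0.
  exists (Num.truncn (e / 2)^-1).
  by rewrite invf_plt ?posrE// truncnS_gt.
have /choice[q hq] : forall i, exists q : rat, `|X i w - ratr q| < m.+1%:R^-1.
  move=> i.
  have [q] := @rat_in_itvoo R (X i w - m.+1%:R^-1) (X i w + m.+1%:R^-1)
    ltac:(by rewrite ltrD2l gtrN).
  rewrite in_itv /= => /andP[q1 q2]; exists q.
  by rewrite distrC ltr_distl q1.
exists ([ffun i => q i], m) => //; rewrite /O' /=.
have wO : O ([ffun i => q i], m) w.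
  by move=> i _; rewrite /= ffunE /ball /= distrC.
case: ifPn => // /asboolP[]; move=> w' w'O; apply: he => i.
have := w'O i I; rewrite /= ffunE /ball /= => h.
have := hq i => h'.
rewrite (_ : X i w' - X i w = - (ratr (q i) - X i w') + (- (X i w - ratr (q i)))); last by ring.
by rewrite (le_lt_trans (ler_normD _ _))// !normrN (lt_trans (ltrD h h'))// [ltRHS]splitr ltrD.
Qed.

End Measurability.

(** * Smooth functions *)

Section Smooth.
Context {R : realType}.
Implicit Types f g : R -> R.

(** The derivative is given as a function rather than by a choice operator, so that
    closure under products goes by induction on n. *)
Fixpoint diff_upto n f : Prop :=
  if n is m.+1 then exists2 g : R -> R, (forall x : R, is_derive x (1 : R) f (g x)) & diff_upto m g
  else True.

Definition smooth f := forall n, diff_upto n f.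

Lemma diff_upto_le n f : diff_upto n.+1 f -> diff_upto n f.
Proof.
by elim: n f => [//|n IH] f [g fg hg]; exists g => //; exact: IH.
Qed.

Lemma diff_upto_cst n (c : R) : diff_upto n (fun=> c).
Proof.
elim: n c => [//|n IH] c; exists (fun=> 0) => // x; exact: is_derive_cst.
Qed.

Lemma diff_uptoD n f g : diff_upto n f -> diff_upto n g ->
  diff_upto n (fun x => f x + g x).
Proof.
elim: n f g => [//|n IH] f g [f' ff' hf'] [g' gg' hg'].
exists (fun x => f' x + g' x); last exact: IH.
by move=> x; apply: is_deriveD.
Qed.

Lemma diff_uptoM n f g : diff_upto n f -> diff_upto n g ->
  diff_upto n (fun x => f x * g x).
Proof.
elim: n f g => [//|n IH] f g hf hg.
have hf1 := diff_upto_le _ _ hf; have hg1 := diff_upto_le _ _ hg.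
case: hf => f' ff' hf'; case: hg => g' gg' hg'.
exists (fun x => f x * g' x + g x * f' x).
  by move=> x; exact: is_deriveM.
by apply: diff_uptoD; exact: IH.
Qed.

Lemma is_derive_affine (a b : R) f (l x : R) : is_derive (a * x + b) 1 f l ->
  is_derive x 1 (fun x : R => f (a * x + b)) (a * l).
Proof.
move=> hf.
have h : is_derive x 1 (fun x : R => a * x + b) a.
  by apply: is_derive_eq; rewrite addr0 scaler1.
by rewrite mulrC; exact: (@is_derive1_comp R f (fun x => a * x + b) x l a hf h).
Qed.

Lemma diff_upto_affine n (a b : R) f : diff_upto n f ->
  diff_upto n (fun x => f (a * x + b)).
Proof.
elim: n f => [//|n IH] f [g fg hg].
exists (fun x => a * g (a * x + b)); first by move=> x; exact: is_derive_affine.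
apply: (diff_uptoM n (fun=> a)); [exact: diff_upto_cst|exact: IH].
Qed.

Lemma smooth_derive1n f : smooth f -> forall j, smooth (derive1n j f).
Proof.
move=> sf; elim=> [//|j IH] n; have [g fg hg] := IH n.+1.
rewrite (_ : derive1n j.+1 f = g)//; apply/funext => x /=.
by rewrite derive1E; have := fg x => -[].
Qed.

Lemma smooth_derivable f : smooth f -> forall j x, derivable (derive1n j f) x 1.
Proof. by move=> sf j x; have [g fg _] := smooth_derive1n f sf j 1; case: (fg x). Qed.

(** From e^y = (e^(y / j))^j and e^(y / j) >= y / j. *)
Lemma pow_le_expR (j : nat) (y : R) : 0 <= y -> y ^+ j <= j%:R ^+ j * expR y.
Proof.
case: j => [|j] y0.
  by rewrite !expr0 mul1r (le_trans _ (expR_ge1Dx y))// lerDl.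
have -> : expR y = expR (y / j.+1%:R) ^+ j.+1.
  by rewrite -expRM_natr divfK.
rewrite -exprMn; apply: lerXn2r; rewrite ?nnegrE ?mulr_ge0 ?expR_ge0//.
rewrite mulrC -ler_pdivrMr ?ltr0n//.
by apply: le_trans (expR_ge1Dx _); rewrite lerDr.
Qed.

(** The derivatives of e^(- 1 / x) are combinations of these functions, all of which vanish
    to second order at 0. *)
Definition flat (m : nat) (x : R) : R := if 0 < x then x^-1 ^+ m * expR (- x^-1) else 0.

(** For a point where no single formula describes f on both sides. *)
Lemma is_derive_of_quadratic f (x l C : R) :
  (forall y, `|f y - f x - l * (y - x)| <= C * (y - x) ^+ 2) ->
  is_derive x 1 f l.
Proof.
move=> hf.
have C0 : 0 <= C.
  by have := le_trans (normr_ge0 _) (hf (x + 1)); rewrite addrC addKr expr1n mulr1.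
have cv : h^-1 *: (f (h *: 1 + x) - f x) @[h --> 0^'] --> l.
  apply/cvgrPdist_le => e e0; near=> h.
  have h0 : h != 0 by near: h; exact: nbhs_dnbhs_neq.
  have hC : (C + 1) * `|h| <= e.
    rewrite mulrC -ler_pdivlMr ?ltr_wpDl//; near: h; apply: dnbhs0_le.
    by rewrite divr_gt0 ?ltr_wpDl.
  rewrite -(ler_pM2l (_ : 0 < `|h|)) ?normr_gt0// -normrM.
  have -> : h * (l - h^-1 *: (f (h *: 1 + x) - f x)) =
     - (f (h + x) - f x - l * (h + x - x)).
    rewrite /GRing.scale /= mulr1; field; exact: h0.
  rewrite normrN (le_trans (hf _))// addrK -real_normK ?num_real// expr2 mulrCA.
  apply: ler_wpM2l => //; apply: le_trans hC; apply: ler_wpM2r => //.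
  by rewrite lerDl.
split; first by apply/cvg_ex; exists l.
by apply/cvg_lim.
Unshelve. all: by end_near. Qed.

Lemma flat_derive (m : nat) (x : R) : is_derive x 1 (flat m) (- m%:R * flat m.+1 x + flat m.+2 x).
Proof.
have [x0|x0|->] := ltgtP x 0.
- have e : \forall y \near x, 0 = flat m y.
    have h : \forall y \near x, y < 0 by exact: (open_nbhs_nbhs (conj (@open_lt R 0) x0)).
    by apply: filterS h => y y0; rewrite /flat ifN// -leNgt ltW.
  apply: near_eq_is_derive e _.
  rewrite /flat !ifN -?leNgt ?ltW// mulr0 addr0; exact: is_derive_cst.
- have e : \forall y \near x, y^-1 ^+ m * expR (- y^-1) = flat m y.
    have h : \forall y \near x, 0 < y by exact: (open_nbhs_nbhs (conj (@open_gt R 0) x0)).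
    by apply: filterS h => y y0; rewrite /flat ifT.
  apply: near_eq_is_derive e _.
  have xn0 : x != 0 by rewrite gt_eqF.
  have dV : is_derive x 1 (fun y : R => y^-1) (- (x ^- 2)).
    by have := @is_deriveV R id x 1 1 xn0 (is_derive_id _ _); rewrite scaler1.
  have dX : is_derive x 1 (fun y : R => y^-1 ^+ m) (- m%:R * x^-1 ^+ m.+1).
    have := @is_deriveX R R (fun y => y^-1) m x 1 _ dV.
    rewrite (_ : (fun y => y^-1) ^+ m = fun y => y^-1 ^+ m); last first.
      by apply/funext => y; rewrite fctE.
    move=> h; apply: is_derive_eq h _.
    rewrite /GRing.scale /=; case: (m) => [|j].
      by rewrite !mulr0n !mul0r oppr0 mul0r.
    by rewrite /= -exprVn -(addn2 j) exprD; ring.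
  have dE : is_derive x 1 (fun y : R => expR (- y^-1)) (expR (- x^-1) * x ^- 2).
    have dN : is_derive x 1 (fun y : R => - y^-1) (x ^- 2).
      by apply: is_derive_eq; rewrite opprK.
    exact: (@is_derive1_comp R expR _ x _ _ (is_derive_expR _) dN).
  apply: (is_derive_eq (is_deriveM dX dE)).
  by rewrite /flat x0 /GRing.scale /= -exprVn -(addn2 m) exprD; ring.
- apply: (@is_derive_of_quadratic _ _ _ (m.+2%:R ^+ m.+2)) => y.
  rewrite /flat ltxx mulr0 addr0 mul0r !subr0; case: ifPn => [y0|_]; last first.
    by rewrite normr0 mulr_ge0 ?sqr_ge0 ?exprn_ge0.
  rewrite ger0_norm ?mulr_ge0 ?exprn_ge0 ?expR_ge0 ?invr_ge0 ?(ltW y0)//.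
  have := @pow_le_expR m.+2 y^-1; rewrite invr_ge0 => /(_ (ltW y0)).
  have -> : y^-1 ^+ m.+2 = y^-1 ^+ m / y ^+ 2.
    by rewrite -(addn2 m) exprD [y^-1 ^+ 2]exprVn.
  rewrite ler_pdivrMr ?exprn_gt0// expRN => h.
  by rewrite ler_pdivrMr ?expR_gt0// mulrAC.
Qed.

End Smooth.

(** * Mollified B-splines *)

Section Splines.
Context {R : realType}.
Implicit Types f g F : R -> R.
Local Notation mu := (@lebesgue_measure R).

Lemma diff_upto_flat n m : diff_upto n (@flat R m).
Proof.
elim: n m => [//|n IH] m; exists (fun x => - m%:R * flat m.+1 x + flat m.+2 x).
  by move=> x; exact: flat_derive.
apply: diff_uptoD => //; apply: (diff_uptoM n (fun=> - m%:R)) => //.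
exact: diff_upto_cst.
Qed.

Definition bump : R -> R := fun x => flat 0 x * flat 0 (1 - x).

Lemma smooth_bump : smooth bump.
Proof.
move=> n; apply: diff_uptoM; first exact: diff_upto_flat.
have := diff_upto_affine n (-1) 1 _ (diff_upto_flat n 0).
by congr (diff_upto n _); apply/funext => x; rewrite mulN1r addrC.
Qed.

Lemma bump_ge0 x : 0 <= bump x.
Proof.
by rewrite /bump /flat; do 2 case: ifP => _; rewrite ?mul0r ?mulr0// !expr0 !mul1r mulr_ge0 ?expR_ge0.
Qed.

Lemma bump_gt0 x : 0 < x < 1 -> 0 < bump x.
Proof.
move=> /andP[x0 x1]; rewrite /bump /flat x0 subr_gt0 x1.
by rewrite !expr0 !mul1r mulr_gt0 ?expR_gt0.
Qed.

Lemma bump_eq0 x : x <= 0 \/ 1 <= x -> bump x = 0.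
Proof.
rewrite /bump /flat => -[x0|x1]; first by rewrite ltNge x0 mul0r.
by rewrite subr_gt0 [x < 1]ltNge x1 mulr0.
Qed.

Lemma smooth_continuous f : smooth f -> continuous f.
Proof.
move=> sf x; have [g fg _] := sf 1%N.
by apply/differentiable_continuous/derivable1_diffP; case: (fg x).
Qed.

Lemma is_derive_continuous F f : (forall x : R, is_derive x 1 F (f x)) -> continuous F.
Proof.
by move=> Ff x; apply/differentiable_continuous/derivable1_diffP; case: (Ff x).
Qed.

Lemma mean_value F f a b : (forall x : R, is_derive x 1 F (f x)) -> a < b ->
  exists2 c, a < c < b & F b - F a = f c * (b - a).
Proof.
move=> Ff ab.
have := @MVT R F f a b ab (fun x _ => Ff x)
  (continuous_subspaceT (is_derive_continuous F f Ff)).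
by move=> [c]; rewrite in_itv /= => cab E; exists c.
Qed.

Definition vanishes_outside p q f := forall x, x < p \/ q < x -> f x = 0.

Lemma notin_segment (p q x : R) : x \notin `[p, q]%classic -> x < p \/ q < x.
Proof.
move=> /negP xpq; have [xp|px] := ltP x p; first by left.
right; rewrite ltNge; apply/negP => xq; apply: xpq.
by rewrite inE /= in_itv /= px xq.
Qed.

Lemma integrable_vanishes p q f (D : set R) : measurable D ->
  mu.-integrable `[p, q]%classic (EFin \o f) -> vanishes_outside p q f ->
  mu.-integrable D (EFin \o f).
Proof.
move=> mD intf f0; apply: (@integrableS _ _ _ _ setT) => //.
move/integrable_mkcond : intf => /(_ (measurable_itv _)).
congr (integrable _ _ _); apply/funext => x; rewrite patchE.
by case: ifPn => // /notin_segment xpq; rewrite /= f0.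
Qed.

Lemma compact_support_integrable p q f (D : set R) : measurable D ->
  continuous f -> vanishes_outside p q f -> mu.-integrable D (EFin \o f).
Proof.
move=> mD cf f0; apply: (integrable_vanishes p q) => //.
apply: continuous_compact_integrable; first exact: segment_compact.
exact: continuous_subspaceT.
Qed.

Lemma exists_antiderivative p q f : continuous f -> vanishes_outside p q f ->
  exists F, forall x : R, is_derive x 1 F (f x).
Proof.
move=> cf f0; exists (fun x => \int[mu]_(t in `]-oo, x]) f t) => x.
have := @continuous_FTC1 R f -oo%O x (x + 1).
rewrite ltrDl ltr01 => /(_ isT).
case=> [|||d1 d2].
- apply: (compact_support_integrable p q) => //; exact: measurable_itv.
- by rewrite ltNyr.
- exact: cf.
by split=> //; rewrite -derive1E.
Qed.

(** K 0 is a mollifier of mass one (F is its distribution function) and K m is, up to the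
    sign (-1) ^ m, its convolution with the m-fold B-spline of step h: K m.+1 x is minus
    the integral of K m over [x - h, x].  The mollifier is supported on the left of 0, so
    that even its translate to the right end of [0, 1] is a test function of ]0, 1[. *)
Lemma spline_sequence (h delta : R) : 0 < h -> 0 < delta ->
  exists K : nat -> R -> R,
  [/\ forall m, smooth (K m),
      forall m, vanishes_outside (- (2 * delta)) (m%:R * h - delta) (K m),
      forall m (x : R), is_derive x 1 (K m.+1) (K m (x - h) - K m x),
      forall m x, `|K m.+1 x| <= h ^+ m &
      (forall x, 0 <= K 0%N x) /\ exists F, [/\ forall x : R, is_derive x 1 F (K 0%N x),
        forall x, x <= - (2 * delta) -> F x = 0 &
        forall x, - delta <= x -> F x = 1] ].
Proof.
move=> h0 d0.
have dn0 : delta != 0 by rewrite gt_eqF.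
have b0 : vanishes_outside 0 1 bump.
  by move=> x [/ltW|/ltW] xx; apply: bump_eq0; [left|right].
have [B hB] := exists_antiderivative _ _ _ (smooth_continuous _ smooth_bump) b0.
have [c0 c01 Bc] := mean_value _ _ _ _ hB (@ltr01 R).
pose c := B 1 - B 0.
have cgt0 : 0 < c by rewrite /c Bc subr0 mulr1 bump_gt0.
have cn0 : c != 0 by rewrite gt_eqF.
pose K0 x := (c * delta)^-1 * bump (delta^-1 * x + 2).
have sK0 : smooth K0.
  move=> n; apply: (diff_uptoM n (fun=> (c * delta)^-1)); first exact: diff_upto_cst.
  by apply: diff_upto_affine; exact: smooth_bump.
have K00 x : 0 <= K0 x.
  by rewrite mulr_ge0 ?bump_ge0// invr_ge0 mulr_ge0// ltW.
have vK0 : vanishes_outside (- (2 * delta)) (- delta) K0.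
  move=> x hx; rewrite /K0 bump_eq0 ?mulr0//.
  case: hx => hx; [left|right].
    by rewrite -lerBrDr sub0r mulrC ler_pdivrMr// mulNr ltW.
  by rewrite -lerBlDr mulrC ler_pdivlMr//; lra.
pose F x := c^-1 * (B (delta^-1 * x + 2) - B 0).
have dF (x : R) : is_derive x 1 F (K0 x).
  have h1 := is_derive_affine delta^-1 2 B _ x (hB _).
  have h2 : is_derive x 1 (fun x : R => B (delta^-1 * x + 2) - B 0)
       (delta^-1 * bump (delta^-1 * x + 2)).
    by apply: is_derive_eq; rewrite oppr0 addr0.
  have := is_deriveZ c^-1 h2.
  move=> h3; apply: is_derive_eq h3 _.
  by rewrite /GRing.scale /= mulrA -invfM.
have F0 : F (- (2 * delta)) = 0.
  rewrite /F (_ : delta^-1 * - (2 * delta) + 2 = 0) ?subrr ?mulr0//.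
  by field.
have F1 : F (- delta) = 1.
  rewrite /F (_ : delta^-1 * - delta + 2 = 1); last by field.
  by rewrite -/c mulVf.
have Fmon x y : x <= y -> F x <= F y.
  rewrite le_eqVlt => /predU1P[->//|xy].
  have [z _ E] := mean_value _ _ _ _ dF xy.
  by rewrite -subr_ge0 E mulr_ge0// subr_ge0 ltW.
have Fl x : x <= - (2 * delta) -> F x = 0.
  rewrite le_eqVlt => /predU1P[->|x1]; first by rewrite F0.
  have [z /andP[_ z1] E] := mean_value _ _ _ _ dF x1.
  by rewrite -[F x](subrK (F (- (2 * delta)))) -opprB E vK0 ?mul0r ?oppr0 ?add0r ?F0//; left.
have Fr x : - delta <= x -> F x = 1.
  rewrite le_eqVlt => /predU1P[<-|x1]; first by rewrite F1.
  have [z /andP[z1 _] E] := mean_value _ _ _ _ dF x1.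
  by rewrite -[F x](subrK (F (- delta))) E vK0 ?mul0r ?add0r ?F1//; right.
have F01 x : 0 <= F x <= 1.
  apply/andP; split.
    have [/Fl->//|/ltW x1] := leP x (- (2 * delta)); by rewrite -F0; exact: Fmon.
  have [x2|/ltW/Fr->//] := leP x (- delta); by rewrite -F1; exact: Fmon.
have /choice[anti hanti] : forall f, exists A : R -> R,
    (smooth f /\ exists p q, vanishes_outside p q f) ->
    forall x : R, is_derive x 1 A (f x).
  move=> f; have [[sf [p [q fpq]]]|nf] :=
      pselect (smooth f /\ exists p q, vanishes_outside p q f).
    have [A hA] := exists_antiderivative p q f (smooth_continuous _ sf) fpq.
    by exists A.
  by exists (fun=> 0).
pose K := fix K m := if m is m'.+1 then fun x => anti (K m') (x - h) - anti (K m') x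
  else K0.
have props m : smooth (K m) /\
   vanishes_outside (- (2 * delta)) (m%:R * h - delta) (K m).
  elim: m => [|m [sK vK]]; first by rewrite mul0r sub0r.
  have dA : forall x : R, is_derive x 1 (anti (K m)) (K m x).
    by apply: hanti; split=> //; exists (- (2 * delta)), (m%:R * h - delta).
  have sA : smooth (anti (K m)).
    by move=> [//|n]; exists (K m) => //; exact: sK.
  split=> [n|x hx] /=.
    apply: (diff_uptoD n (fun x => anti (K m) (x - h)) (fun x => - anti (K m) x)).
      have := diff_upto_affine n 1 (- h) _ (sA n).
      by congr (diff_upto n _); apply/funext => x; rewrite mul1r.
    have := diff_uptoM n (fun=> -1) _ (diff_upto_cst n (-1)) (sA n).
    by congr (diff_upto n _); apply/funext => x; rewrite mulN1r.
  have xh : x - h < x by rewrite gtrBl.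
  have [z /andP[z1 z2] E] := mean_value _ _ _ _ dA xh.
  rewrite -opprB E vK ?mul0r ?oppr0//; case: hx => hx; [left|right].
    exact: lt_trans hx.
  by move: hx; rewrite -natr1 => hx; lra.
have dA m : forall x : R, is_derive x 1 (anti (K m)) (K m x).
  apply: hanti; split; first by case: (props m).
  by exists (- (2 * delta)), (m%:R * h - delta); case: (props m).
exists K; split.
- by move=> m; case: (props m).
- by move=> m; case: (props m).
- move=> m x; apply: (@is_deriveB R R R (fun x => anti (K m) (x - h)) (anti (K m))).
  have := is_derive_affine 1 (- h) (anti (K m)) (K m (x - h)) x.
  rewrite !mul1r => /(_ (dA m _)).
  by congr (is_derive _ _ _ _); apply/funext => y; rewrite mul1r.
- elim=> [|m IH] x.
    have E y : anti (K 0%N) y - F y = anti (K 0%N) 0 - F 0.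
      have dG (z : R) : is_derive z 1 (fun y => anti (K 0%N) y - F y) ((fun=> 0) z).
        by apply: (is_derive_eq (is_deriveB (dA 0%N z) (dF z))); exact: subrr.
      have [y0|y0|->//] := ltgtP y 0.
        have [z _] := mean_value _ _ _ _ dG y0; rewrite mul0r => /eqP.
        by rewrite subr_eq0 => /eqP.
      have [z _] := mean_value _ _ _ _ dG y0; rewrite mul0r => /eqP.
      by rewrite subr_eq0 => /eqP.
    rewrite /= (_ : _ - _ = F (x - h) - F x); last first.
      by have := E x; have := E (x - h); rewrite /=; lra.
    rewrite expr0 ler_norml; have /andP[a1 a2] := F01 x.
    by have /andP[a3 a4] := F01 (x - h); apply/andP; split; lra.
  have xh : x - h < x by rewrite gtrBl.
  have [z _ E] := mean_value _ _ _ _ (dA m.+1) xh.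
  change (`|anti (K m.+1) (x - h) - anti (K m.+1) x| <= h ^+ m.+1).
  by rewrite distrC E normrM exprSr subKr [X in _ * X]gtr0_norm// ler_pM2r.
- by split=> //; exists F.
Qed.

End Splines.

(** * Pairings with test functions *)

Section WeakDerivatives.
Context {R : realType}.
Implicit Types f g phi : R -> R.
Local Notation mu := (@lebesgue_measure R).

Definition pairing g phi : R := \int[mu]_(x in `]0, 1[%classic) (g x * phi x).

Lemma smooth_test_function p q phi : smooth phi -> 0 < p -> q < 1 ->
  vanishes_outside p q phi -> test_function phi.
Proof.
move=> sphi p0 q1 vphi.
have sub : [set x | phi x != 0] `<=` `[p, q]%classic.
  move=> x /= /eqP phx; rewrite in_itv /=.
  by rewrite !leNgt; apply/andP; split; apply/negP => xx; apply: phx;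
    apply: vphi; [left|right].
have csub : closure [set x | phi x != 0] `<=` `[p, q]%classic.
  have cpq : closed (`[p, q]%classic : set R).
    by apply: compact_closed; [exact: Rhausdorff|exact: segment_compact].
  by move/closure_id: cpq => ->; exact: closureS.
split.
- exact: smooth_derivable.
- by apply: subclosed_compact csub => //; [exact: closed_closure|exact: segment_compact].
- move=> x /csub; rewrite /= !in_itv /= => /andP[px xq].
  by rewrite (lt_le_trans p0 px) (le_lt_trans xq q1).
Qed.

Lemma Rintegral_vanishes p q (G : R -> R) (D : set R) :
  `[p, q]%classic `<=` D -> vanishes_outside p q G ->
  \int[mu]_(x in D) G x = \int[mu]_(x in `[p, q]%classic) G x.
Proof.
move=> sub vG; rewrite Rintegral_mkcond [RHS]Rintegral_mkcond.
apply: eq_Rintegral => x _; rewrite !patchE.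
have [xpq|/notin_segment xpq] := boolP (x \in `[p, q]%classic).
  by rewrite mem_set//; apply/sub/set_mem.
by rewrite vG//; case: ifP.
Qed.

Lemma itv_sub01 (p q : R) : 0 < p -> q < 1 -> `[p, q]%classic `<=` (`]0, 1[%classic : set R).
Proof.
move=> p0 q1 x; rewrite /= !in_itv /= => /andP[px xq].
by rewrite (lt_le_trans p0 px) (le_lt_trans xq q1).
Qed.

Lemma pairing_integrable p q g phi : locally_integrable `]0, 1[%classic g ->
  continuous phi -> 0 < p -> q < 1 -> vanishes_outside p q phi ->
  mu.-integrable `]0, 1[%classic (EFin \o (fun x => g x * phi x)).
Proof.
move=> [mg _ lg] cphi p0 q1 vphi.
have sub := itv_sub01 p q p0 q1.
apply: (integrable_vanishes p q); first exact: measurable_itv.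
  have ig : mu.-integrable `[p, q]%classic (EFin \o g).
    apply/integrableP; split.
      apply/measurable_EFinP; apply: (measurable_funS _ sub mg).
      exact: measurable_itv.
    exact: (lg _ sub (@segment_compact _ _ _)).
  have mphi : measurable_fun `[p, q]%classic phi.
    by apply: measurable_funTS; exact: continuous_measurable_fun.
  have bphi : [bounded phi x | x in `[p, q]%classic].
    have cpq : {within `[p, q]%classic, continuous (phi : R -> R^o)}.
      exact: continuous_subspaceT.
    have /compact_bounded[M [_ mrt]] := continuous_compact cpq (@segment_compact R p q).
    by exists M; split; rewrite ?num_real// => ? ? ? ?; exact: mrt.
  have : mu.-integrable `[p, q]%classic ((EFin \o g) \* (EFin \o phi))%E.
    by apply: integrableMl => //; exact: measurable_itv.
  by congr (integrable _ _ _).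
by move=> x hx; rewrite vphi ?mulr0.
Qed.

Lemma pairingB p q g phi psi : locally_integrable `]0, 1[%classic g ->
  continuous phi -> continuous psi -> 0 < p -> q < 1 ->
  vanishes_outside p q phi -> vanishes_outside p q psi ->
  pairing g (fun x => phi x - psi x) = pairing g phi - pairing g psi.
Proof.
move=> lg cphi cpsi p0 q1 vphi vpsi.
rewrite /pairing -RintegralB//=.
- by apply: eq_Rintegral => x _; rewrite mulrBr.
- exact: (pairing_integrable p q).
- exact: (pairing_integrable p q).
Qed.

Lemma pairing_weak_derivative p q f g phi psi : weak_derivative f g ->
  smooth phi -> (forall x : R, is_derive x 1 phi (psi x)) ->
  0 < p -> q < 1 -> vanishes_outside p q phi ->
  pairing f psi = - pairing g phi.
Proof.
move=> [_ _ wd] sphi dphi p0 q1 vphi.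
rewrite /pairing -(wd phi (smooth_test_function p q phi sphi p0 q1 vphi)).
apply: eq_Rintegral => x _; congr (_ * _).
by rewrite derive1E; case: (dphi x).
Qed.

Lemma Rintegral_derive p q phi psi : continuous psi ->
  (forall x : R, is_derive x 1 phi (psi x)) ->
  0 < p -> q < 1 -> vanishes_outside p q psi ->
  \int[mu]_(x in `]0, 1[%classic) psi x = phi 1 - phi 0.
Proof.
move=> cpsi dphi p0 q1 vpsi.
have sub := itv_sub01 p q p0 q1.
rewrite (Rintegral_vanishes p q)//.
have sub' : `[p, q]%classic `<=` (`[0, 1]%classic : set R).
  by apply: (subset_trans sub); exact: subset_itv_oo_cc.
rewrite -(Rintegral_vanishes p q psi `[0, 1]%classic)// /Rintegral.
have cphi := is_derive_continuous phi psi dphi.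
rewrite (@continuous_FTC2 _ psi phi 0 1)//.
- exact: continuous_subspaceT.
- split.
  + by move=> x _; case: (dphi x).
  + by apply: cvg_at_right_filter; exact: cphi.
  + by apply: cvg_at_left_filter; exact: cphi.
- by move=> x _; rewrite derive1E; case: (dphi x).
Qed.

(** With a psi of zero integral this bounds a pairing by an oscillation of g; with a
    mollifier of mass one it compares a pairing with a point value. *)
Lemma pairing_centered_le p q g psi (c V : R) :
  locally_integrable `]0, 1[%classic g -> continuous psi ->
  0 < p -> q < 1 -> vanishes_outside p q psi ->
  (forall x, p <= x <= q -> `|g x - c| <= V) ->
  `|pairing g psi - c * \int[mu]_(x in `]0, 1[%classic) psi x|
    <= V * \int[mu]_(x in `]0, 1[%classic) `|psi x|.
Proof.
move=> lg cpsi p0 q1 vpsi gV.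
have ipsi : mu.-integrable `]0, 1[%classic (EFin \o psi).
  by apply: (compact_support_integrable p q) => //; exact: measurable_itv.
have inpsi : mu.-integrable `]0, 1[%classic (EFin \o (fun x => `|psi x|)).
  exact: integrable_norm ipsi.
have ig := pairing_integrable p q g psi lg cpsi p0 q1 vpsi.
have iZ (f : R -> R) (a : R) : mu.-integrable `]0, 1[%classic (EFin \o f) ->
    mu.-integrable `]0, 1[%classic (EFin \o (fun x => a * f x)).
  move=> h; have : mu.-integrable `]0, 1[%classic (fun x => a%:E * (f x)%:E)%E.
    by apply: integrableZl => //; exact: measurable_itv.
  by congr (integrable _ _ _).
have icpsi := iZ psi c ipsi.
have -> : pairing g psi - c * \int[mu]_(x in `]0, 1[%classic) psi x =
    \int[mu]_(x in `]0, 1[%classic) ((g x - c) * psi x).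
  under [RHS]eq_Rintegral do rewrite mulrBl.
  by rewrite RintegralB//= RintegralZl.
have iG : mu.-integrable `]0, 1[%classic (EFin \o (fun x => (g x - c) * psi x)).
  have : mu.-integrable `]0, 1[%classic
      ((EFin \o (fun x => g x * psi x)%R) \- (EFin \o (fun x => c * psi x)%R))%E.
    by apply: integrableB => //; exact: measurable_itv.
  by congr (integrable _ _ _); apply/funext => x /=; rewrite mulrBl.
apply: (@le_trans _ _ (\int[mu]_(x in `]0, 1[%classic) `|(g x - c) * psi x|)).
  by apply: le_normr_Rintegral => //; exact: measurable_itv.
rewrite -RintegralZl//=.
apply: le_Rintegral => //; [exact: integrable_norm iG|exact: iZ|].
move=> x _; rewrite normrM.
have [xp|px] := ltP x p; first by rewrite vpsi ?normr0 ?mulr0//; left.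
have [qx|xq] := ltP q x; first by rewrite vpsi ?normr0 ?mulr0//; right.
by apply: ler_wpM2r => //; apply: gV; rewrite px xq.
Qed.

Lemma Rintegral_norm_le p q psi (b : R) : continuous psi ->
  0 < p -> q < 1 -> p <= q -> vanishes_outside p q psi ->
  (forall x, `|psi x| <= b) ->
  \int[mu]_(x in `]0, 1[%classic) `|psi x| <= b * (q - p).
Proof.
move=> cpsi p0 q1 pq vpsi psib.
rewrite (Rintegral_vanishes p q) //; last 2 first.
- exact: itv_sub01.
- by move=> x hx; rewrite vpsi ?normr0.
have mpq : mu `[p, q]%classic = (q - p)%:E.
  by rewrite lebesgue_measure_itv /= lte_fin; case: ltgtP pq => // -> _; rewrite subrr.
apply: (@le_trans _ _ (\int[mu]_(x in `[p, q]%classic) b)).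
  apply: le_Rintegral => //.
  - apply: integrable_norm.
    by apply: (compact_support_integrable p q) => //; exact: measurable_itv.
  - apply/integrableP; split; first exact: measurable_cst.
    rewrite integral_cst//.
    by rewrite [X in (_ * X)%E]mpq -EFinM ltry.
rewrite Rintegral_cst; last exact: measurable_itv.
by rewrite [X in fine X]mpq.
Qed.

End WeakDerivatives.

(** * Differences of functions with a derivative of bounded variation *)

Section ClassDifferences.
Context {R : realType}.
Implicit Types f g : R -> R.
Local Notation mu := (@lebesgue_measure R).

(** Increments of v telescope along a grid, which oscillations of g do not. *)
Lemma variation_function (g : R -> R) (C : R) :
  (total_variation 0 1 g <= C%:E)%E ->
  exists v : R -> R, [/\ forall x y, 0 <= x -> x <= y -> y <= 1 ->
      `|g y - g x| <= v y - v x, v 0 = 0 & v 1 <= C].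
Proof.
move=> hC; exists (fun x => fine (total_variation 0 x g)).
have fin x : 0 <= x -> x <= 1 -> total_variation 0 x g \is a fin_num.
  move=> x0 x1; rewrite ge0_fin_numE ?total_variation_ge0//.
  apply: (@le_lt_trans _ _ C%:E); last exact: ltry.
  apply: le_trans hC; rewrite (total_variationD g x0 x1).
  by rewrite leeDl// total_variation_ge0.
split.
- move=> x y x0 xy y1; have y0 := le_trans x0 xy; have x1 := le_trans xy y1.
  have := total_variationD g x0 xy.
  have fx := fin x x0 x1; have fy := fin y y0 y1.
  have := total_variation_ge g xy.
  rewrite -(fineK fx) -(fineK fy) /=.
  case: (total_variation x y g) => [r|//|//].
  by rewrite lee_fin => h [->]; rewrite addrAC subrr add0r.
- by rewrite total_variationxx.
- by rewrite -lee_fin fineK// fin.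
Qed.

Lemma oscillation_le (g v : R -> R) (a b x c : R) :
  (forall x y, 0 <= x -> x <= y -> y <= 1 -> `|g y - g x| <= v y - v x) ->
  0 <= a -> b <= 1 -> a <= x <= b -> a <= c <= b -> `|g x - g c| <= v b - v a.
Proof.
move=> gv a0 b1 /andP[ax xb] /andP[ac cb].
have mon y z : 0 <= y -> y <= z -> z <= 1 -> v y <= v z.
  by move=> y0 yz z1; rewrite -subr_ge0; apply: le_trans (gv y z y0 yz z1).
have [cx|/ltW xc] := leP c x.
  apply: (le_trans (gv c x _ cx _)); [lra|lra|].
  by apply: lerB; apply: mon; lra.
rewrite distrC; apply: (le_trans (gv x c _ xc _)); [lra|lra|].
by apply: lerB; apply: mon; lra.
Qed.

Lemma iter_fdiff_dist m (a b : nat -> R) i (w : R) :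
  (forall j, (i <= j <= i + m)%N -> `|a j - b j| <= w) ->
  `|iter m fdiff a i - iter m fdiff b i| <= 2 ^+ m * w.
Proof.
elim: m i => [|m IH] i h; first by rewrite expr0 mul1r; apply: h; lia.
rewrite /= /fdiff.
have -> : iter m fdiff a i.+1 - iter m fdiff a i -
    (iter m fdiff b i.+1 - iter m fdiff b i) =
    (iter m fdiff a i.+1 - iter m fdiff b i.+1) -
    (iter m fdiff a i - iter m fdiff b i) by ring.
rewrite (le_trans (ler_normB _ _))// exprS mulr_natl mulr2n mulrDl.
by apply: lerD; apply: IH => j hj; apply: h; lia.
Qed.

Lemma common_delta m (Q : nat -> R -> Prop) :
  (forall j d d', d' <= d -> Q j d -> Q j d') ->
  (forall j, (j < m)%N -> exists2 d, 0 < d & Q j d) ->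
  exists2 d, 0 < d & forall j, (j < m)%N -> Q j d.
Proof.
move=> mono; elim: m => [|m IH] ex; first by exists 1.
have [d1 d10 h1] := IH (fun j jm => ex j (ltnW jm)).
have [d2 d20 h2] := ex m (leqnn _).
exists (Num.min d1 d2); first by rewrite lt_min d10.
move=> j; rewrite ltnS leq_eqVlt => /predU1P[->|jm].
  by apply: mono h2; rewrite ge_min lexx orbT.
by apply: mono (h1 j jm); rewrite ge_min lexx.
Qed.

Lemma within_continuous_delta f (x w : R) : {within `[0, 1], continuous f} ->
  0 <= x <= 1 -> 0 < w -> exists2 d, 0 < d &
    forall y, 0 <= y <= 1 -> `|y - x| < d -> `|f y - f x| <= w.
Proof.
move=> cf x01 w0.
have := (subspace_continuousP _ _).1 cf x; rewrite /= in_itv /= => /(_ x01).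
move=> /cvgrPdist_le /(_ w w0); rewrite /within /=.
move=> /nbhs_ballP[d d0 hd]; exists d => // y y01 yx.
rewrite distrC; apply: hd; last by rewrite in_itv.
by rewrite /ball /= distrC.
Qed.

(** For 0 < k, let phi m j be the spline K m moved to the grid point x j, and u m j its
    pairing with the m-th weak derivative D m.  The derivative of phi m.+1 j is the
    difference in j of phi m, so that integration by parts gives fdiff (u m) = - u m.+1.
    Thus k differences of the mollified values u 0 of f are, up to sign, pairings of D k
    with splines of height h ^ k.-1.  The last difference leaves a function of zero
    integral supported in [i / n, (i + k.+2) / n], which only sees the oscillation of D k
    there.  The mollification disappears in the limit, as f is continuous. *)
Lemma class_diff_le_osc k (f : R -> R) (D : nat -> R -> R) (v : R -> R) n i :
  ((0 < k)%N -> {within `[0, 1], continuous f}) -> D 0%N = f ->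
  (forall j : nat, (j < k)%N -> weak_derivative (D j) (D j.+1)) ->
  (forall x y, 0 <= x -> x <= y -> y <= 1 -> `|D k y - D k x| <= v y - v x) ->
  (i + k.+1 < n)%N ->
  `|iter k.+1 fdiff (fun j => f (j.+1%:R / n%:R)) i|
    <= 2 * k.+2%:R * n%:R ^- k * (v ((i + k.+2)%:R / n%:R) - v (i%:R / n%:R)).
Proof.
move=> cf D0 wD gv ikn.
have n0 : 0 < n%:R :> R by rewrite ltr0n; lia.
pose h : R := n%:R^-1; have h0 : 0 < h by rewrite invr_gt0.
have hn : n%:R * h = 1 by rewrite /h divff// gt_eqF.
have le1 (j : nat) : (j <= n)%N -> j%:R * h <= 1.
  by move=> jn; rewrite -[leRHS]hn; apply: ler_wpM2r; [exact: ltW|rewrite ler_nat].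
have ge0 (j : nat) : 0 <= j%:R * h by rewrite mulr_ge0// ltW.
have mon y z : 0 <= y -> y <= z -> z <= 1 -> v y <= v z.
  by move=> y0 yz z1; rewrite -subr_ge0; apply: le_trans (gv y z y0 yz z1).
have monh (j l : nat) : (j <= l)%N -> j%:R * h <= l%:R * h.
  by move=> jl; apply: ler_wpM2r; [exact: ltW|rewrite ler_nat].
rewrite -[n%:R^-1]/h -/(i%:R * h) -exprVn -/h.
set V := v _ - v _.
have V0 : 0 <= V.
  by rewrite subr_ge0; apply: mon; [exact: ge0|apply: monh; lia|apply: le1; lia].
have [kz|kpos] := posnP k.
  rewrite {}kz in cf wD gv ikn V V0 *.
  rewrite /= /fdiff -D0.
  apply: (@le_trans _ _ V).
    apply: (le_trans (gv _ _ _ _ _)); [exact: ge0|by apply: monh|by apply: le1; lia|].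
    rewrite /V; apply: lerB.
      by apply: mon; [exact: ge0|apply: monh; lia|apply: le1; lia].
    by apply: mon; [exact: ge0|apply: monh; lia|apply: le1; lia].
  by rewrite expr0 mulr1 ler_peMl//; lra.
have {}cf := cf kpos.
pose x (j : nat) : R := j.+1%:R * h.
have xS j : x j.+1 = x j + h by rewrite /x -natr1; ring.
have xadd j (m : nat) : x j + m%:R * h = (j + m.+1)%:R * h.
  by rewrite /x -mulrDl -natrD; congr (_%:R * _); lia.
(* The difference has 2 ^ k.+1 terms, counted with multiplicity; each of them moves
   by at most w under mollification. *)
apply/ler_addgt0Pr => e e0.
pose w := e / 2 ^+ k.+1.
have w0 : 0 < w by rewrite divr_gt0// exprn_gt0.
have [d0 d00 hd0] : exists2 d, 0 < d & forall j, (j < n)%N ->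
    forall y, 0 <= y <= 1 -> `|y - x j| < d -> `|f y - f (x j)| <= w.
  apply: (common_delta n (fun j d => forall y, 0 <= y <= 1 -> `|y - x j| < d ->
     `|f y - f (x j)| <= w)) => [j d d' dd hd y y01 yx|j jn].
    by apply: hd => //; exact: lt_le_trans dd.
  by apply: within_continuous_delta => //; rewrite ge0 le1.
pose delta := Num.min (h / 4) (d0 / 4).
have delta0 : 0 < delta by rewrite lt_min !divr_gt0.
have deltah : delta <= h / 4 by rewrite ge_min lexx.
have deltad : delta <= d0 / 4 by rewrite ge_min lexx orbT.
have [K [sK vK dK bK [K0 [F [dF Fl Fr]]]]] := spline_sequence h delta h0 delta0.
pose phi m j := fun y => K m (y - x j).
have sphi m j : smooth (phi m j).
  move=> l; have := diff_upto_affine l 1 (- x j) _ (sK m l).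
  by congr (diff_upto _ _); apply/funext => y; rewrite mul1r.
have cphi m j : continuous (phi m j) by exact: smooth_continuous.
have vphi m j : vanishes_outside (x j - 2 * delta) (x j + m%:R * h - delta) (phi m j).
  move=> y hy; rewrite /phi vK//.
  by case: hy => hy; [left|right]; lra.
have widen p q p' q' (psi : R -> R) : p' <= p -> q <= q' ->
    vanishes_outside p q psi -> vanishes_outside p' q' psi.
  move=> pp qq vpsi y hy; apply: vpsi; case: hy => hy; [left|right].
    exact: lt_le_trans pp.
  exact: le_lt_trans hy.
have dphi m j (y : R) : is_derive y 1 (phi m.+1 j) (phi m j.+1 y - phi m j y).
  have := is_derive_affine 1 (- x j) (K m.+1) _ y (dK m _).
  rewrite !mul1r /phi xS opprD addrA.
  by congr (is_derive _ _ _ _); apply/funext => z; rewrite mul1r.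
have xh j : h <= x j.
  by rewrite /x ler_peMl ?ler1n// ltW.
have lo j : 0 < x j - 2 * delta by have := xh j; lra.
have hi m j : (j + m < n)%N -> x j + m%:R * h - delta < 1.
  by move=> jm; rewrite xadd; have := le1 (j + m.+1)%N ltac:(by rewrite addnS); lra.
pose u m j := pairing (D m) (phi m j).
have lD m : (m <= k)%N -> locally_integrable `]0, 1[%classic (D m).
  rewrite leq_eqVlt => /predU1P[->|mk]; first by have := wD k.-1; rewrite prednK// => /(_ (leqnn _)) [].
  by have [] := wD m mk.
have pair_diff m j : (m <= k)%N -> (j + m.+1 < n)%N ->
    pairing (D m) (fun y => phi m j.+1 y - phi m j y) = u m j.+1 - u m j.
  move=> mk jmn.
  apply: (pairingB (x j - 2 * delta) (x j + m.+1%:R * h - delta)) => //.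
  - exact: lD.
  - exact: hi.
  - apply: widen (vphi m j.+1); first by rewrite xS; lra.
    by rewrite xS -[m.+1%:R]natr1; lra.
  - apply: widen (vphi m j) => //; rewrite -[m.+1%:R]natr1; lra.
have stepA m j : (m < k)%N -> (j + m.+1 < n)%N -> u m j.+1 - u m j = - u m.+1 j.
  move=> mk jmn; rewrite -pair_diff ?(ltnW mk)//.
  apply: (pairing_weak_derivative (x j - 2 * delta) (x j + m.+1%:R * h - delta)) => //.
  - exact: wD.
  - exact: hi.
have stepB m j : (m <= k)%N -> (j + m < n)%N ->
    iter m fdiff (u 0%N) j = (-1) ^+ m * u m j.
  elim: m j => [|m IH] j mk jm; first by rewrite expr0 mul1r.
  have jm1 : (j.+1 + m < n)%N by rewrite addSn -addnS.
  have jm0 : (j + m < n)%N by apply: ltn_trans jm; rewrite addnS.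
  rewrite iterS /fdiff (IH _ (ltnW mk) jm1) (IH _ (ltnW mk) jm0).
  by rewrite -mulrBr stepA// exprS mulrN mulN1r mulNr.
have fphi0 j : (j < n)%N -> `|f (x j) - u 0%N j| <= w.
  move=> jn.
  have qlt : x j - delta < 1 by have := hi 0%N j; rewrite mul0r addr0 addn0; apply.
  have v0 : vanishes_outside (x j - 2 * delta) (x j - delta) (phi 0%N j).
    by have := vphi 0%N j; rewrite mul0r addr0.
  have int1 : \int[mu]_(y in `]0, 1[%classic) phi 0%N j y = 1.
    have dF' (y : R) : is_derive y 1 (fun y => F (y - x j)) (phi 0%N j y).
      have := is_derive_affine 1 (- x j) F _ y (dF _).
      rewrite !mul1r; congr (is_derive _ _ _ _).
      by apply/funext => z; rewrite mul1r.
    rewrite (Rintegral_derive _ _ _ _ (cphi 0%N j) dF' (lo j) qlt v0).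
    rewrite Fr; last by have := le1 j.+1 jn; rewrite -/(x j); lra.
    by rewrite Fl ?subr0//; have := xh j; lra.
  have := @pairing_centered_le _ (x j - 2 * delta) (x j - delta) f (phi 0%N j)
    (f (x j)) w.
  rewrite -{1}D0 => /(_ (lD 0%N isT) (cphi _ _) (lo _) qlt v0).
  rewrite (_ : \int[mu]_(y in `]0, 1[%classic) `|phi 0%N j y| =
      \int[mu]_(y in `]0, 1[%classic) phi 0%N j y); last first.
    by apply: eq_Rintegral => y _; rewrite ger0_norm//; exact: K0.
  rewrite int1 !mulr1 distrC /u D0; apply.
  move=> y /andP[y1 y2]; apply: hd0 => //.
    apply/andP; split; first by have := lo j; lra.
    by have := le1 j.+1 jn; rewrite -/(x j); lra.
  by rewrite ltr_norml; apply/andP; split; lra.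
(* psi is itself the derivative of a compactly supported spline, hence has zero
   integral, and D k may be centered at its value in x i. *)
have stepC : `|u k i.+1 - u k i| <= 2 * k.+2%:R * h ^+ k * V.
  rewrite -pair_diff//.
  set psi := fun y => _.
  set p := x i - 2 * delta; set q := x i + k.+1%:R * h - delta.
  have vpsi : vanishes_outside p q psi.
    move=> y hy; rewrite /psi.
    rewrite (widen _ _ _ _ _ _ _ (vphi k i.+1) y hy); last 2 first.
    - by rewrite /p xS; lra.
    - by rewrite /q xS -[k.+1%:R]natr1; lra.
    rewrite (widen _ _ _ _ _ _ _ (vphi k i) y hy) ?subrr//.
    by rewrite /q -[k.+1%:R]natr1; lra.
  have cpsi : continuous psi.
    by move=> y; apply: continuousB; exact: cphi.
  have q1 : q < 1 by apply: hi.
  have p0 : 0 < p by exact: lo.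
  have pq : p <= q.
    by rewrite /p /q; have : 1 * h <= k.+1%:R * h := monh 1%N k.+1 isT; lra.
  have int0 : \int[mu]_(y in `]0, 1[%classic) psi y = 0.
    rewrite (Rintegral_derive p q (phi k.+1 i) psi cpsi (dphi k i) p0 q1 vpsi).
    by rewrite !(vphi k.+1 i) ?subrr//; [left|right].
  have osc y : p <= y <= q -> `|D k y - D k (x i)| <= V.
    move=> /andP[py yq].
    have E1 : i%:R * h = x i - h by rewrite /x -natr1; ring.
    have E2 : (i + k.+2)%:R * h = x i + k.+1%:R * h by rewrite xadd.
    apply: (oscillation_le (D k) v) => //.
    - by apply: le1; rewrite addnS.
    - by rewrite E1 E2; apply/andP; split; move: py yq; rewrite /p /q; lra.
    - by rewrite E1 E2; apply/andP; split; have := ge0 k.+1; lra.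
  have bpsi y : `|psi y| <= 2 * h ^+ k.-1.
    rewrite (le_trans (ler_normB _ _))// mulrDl mul1r.
    by apply: lerD; rewrite /phi -[in K k](prednK kpos); exact: bK.
  have := @pairing_centered_le _ p q (D k) psi (D k (x i)) V (lD k (leqnn _))
    cpsi p0 q1 vpsi osc.
  rewrite int0 mulr0 subr0 => hp; apply: (le_trans hp).
  rewrite mulrC; apply: ler_wpM2r => //.
  apply: (le_trans (Rintegral_norm_le p q psi _ cpsi p0 q1 pq vpsi bpsi)).
  have -> : h ^+ k = h * h ^+ k.-1 by rewrite -exprS prednK.
  have hk0 : 0 <= h ^+ k.-1 by rewrite exprn_ge0// ltW.
  have -> : 2 * k.+2%:R * (h * h ^+ k.-1) = 2 * h ^+ k.-1 * (k.+2%:R * h) by ring.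
  apply: ler_wpM2l; first by rewrite mulr_ge0.
  by rewrite /p /q -[k.+2%:R]natr1; clear -deltah h0 delta0; lra.
have := iter_fdiff_dist k.+1 (fun j => f (x j)) (u 0%N) i w.
have -> : iter k.+1 fdiff (u 0%N) i = (-1) ^+ k * (u k i.+1 - u k i).
  have ik1 : (i.+1 + k < n)%N by rewrite addSn -addnS.
  have ik0 : (i + k < n)%N by apply: ltn_trans ikn; rewrite addnS.
  by rewrite iterS /fdiff !stepB// mulrBr.
move=> /(_ _) hh.
have {}hh : `|iter k.+1 fdiff (fun j => f (x j)) i - (-1) ^+ k * (u k i.+1 - u k i)| <= e.
  rewrite -[e](_ : 2 ^+ k.+1 * w = e); last by rewrite /w mulrC divfK// expf_neq0.
  apply: hh => j /andP[_ hj]; apply: fphi0; exact: leq_ltn_trans ikn.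
rewrite -[X in `|X|](subrK ((-1) ^+ k * (u k i.+1 - u k i))) addrC.
rewrite (le_trans (ler_normD _ _))//; apply: lerD => //.
by rewrite normrM normrX normrN1 expr1n mul1r.
Qed.

(** The windows of [class_diff_le_osc] overlap k.+2 times. *)
Lemma class_diff_sum_le k (C : R) (f : R -> R) : in_class k C f -> 0 <= C ->
  forall n, n%:R ^+ k *
    \sum_(j < n - k.+1) `|iter k.+1 fdiff (fun i => f (i.+1%:R / n%:R)) j|
    <= 2 * k.+2%:R ^+ 2 * C.
Proof.
move=> [cf [D [D0 wD tv]]] C0 n.
have [v [gv v0 v1]] := variation_function _ _ tv.
have [->|n0] := eqVneq n 0%N.
  by rewrite big_ord0 mulr0 !mulr_ge0 ?exprn_ge0.
have nR0 : 0 < n%:R :> R by rewrite ltr0n lt0n.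
pose a i := v (i%:R / n%:R).
have mon y z : 0 <= y -> y <= z -> z <= 1 -> v y <= v z.
  by move=> y0 yz z1; rewrite -subr_ge0; apply: le_trans (gv y z y0 yz z1).
have a0 i : (i <= n)%N -> 0 <= a i <= C.
  move=> i_n; have i0 : 0 <= i%:R / n%:R :> R by rewrite divr_ge0.
  have i1 : i%:R / n%:R <= 1 :> R by rewrite ler_pdivrMr// mul1r ler_nat.
  by rewrite /a -{1}v0 mon//= (le_trans _ v1)// mon.
have key m N : (N + m <= n.+1)%N -> \sum_(j < N) (a (j + m)%N - a j) <= m%:R * C.
  elim: m => [|m IH] Nm.
    by rewrite mul0r big1// => j _; rewrite addn0 subrr.
  have -> : \sum_(j < N) (a (j + m.+1)%N - a j) =
      \sum_(j < N) (a (j + m)%N - a j) + (a (N + m)%N - a m).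
    rewrite -[a m]/(a (0 + m)%N).
    rewrite -(telescope_sumr (fun j => a (j + m)%N) (leq0n N)) big_mkord -big_split /=.
    by apply: eq_bigr => j _; rewrite addnS addSn; ring.
  rewrite -natr1 mulrDl mul1r; apply: lerD; first by apply: IH; lia.
  have /andP[_ h1] := a0 (N + m)%N ltac:(lia).
  by have /andP[h2 _] := a0 m ltac:(lia); lra.
rewrite mulr_sumr.
apply: (@le_trans _ _ (\sum_(j < n - k.+1) 2 * k.+2%:R * (a (j + k.+2)%N - a j))).
  apply: ler_sum => j _.
  have jn : (j + k.+1 < n)%N by have := ltn_ord j; lia.
  have := class_diff_le_osc k f D v n j cf D0 wD gv jn.
  move=> h; rewrite mulrC -ler_pdivlMr ?exprn_gt0//.
  by apply: (le_trans h); rewrite mulrAC.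
rewrite -mulr_sumr expr2 mulrA -[leRHS]mulrA; apply: ler_wpM2l.
  by rewrite mulr_ge0.
have [kn|nk] := leqP k.+2 n; first by apply: key; lia.
have -> : (n - k.+1 = 0)%N by lia.
by rewrite big_ord0 mulr_ge0.
Qed.

End ClassDifferences.

(** * Independence and expectations *)

Section Independence.
Import HBNNSimple.
Context {R : realType} {d : measure_display} {T : measurableType d}.
Variable P : probability T R.

Lemma preimage_measurable (X : {RV P >-> R}) (A : set R) :
  measurable A -> measurable (X @^-1` A).
Proof.
move=> mA; have mX : measurable_fun setT X by [].
by rewrite -[X in measurable X]setTI; exact: mX.
Qed.

Lemma integral_indic_preimage (X : {RV P >-> R}) (A : set R) : measurable A ->
  (\int[P]_w (\1_A (X w))%:E)%E = P (X @^-1` A).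
Proof.
move=> mA; transitivity (\int[P]_w (\1_(X @^-1` A) w)%:E)%E.
  by apply: eq_integral => w _; rewrite !indicE.
by rewrite integral_indic// ?setIT//; exact: preimage_measurable.
Qed.

(** The inequality passes from indicators to simple functions by linearity, and to
    nonnegative functions by monotone convergence. *)
Lemma le_integral_transfer (psi : T -> R) (X : {RV P >-> R}) (g : R -> R) (c : R) :
  measurable_fun setT psi -> (forall w, 0 <= psi w) ->
  measurable_fun setT g -> (forall x, 0 <= g x) -> 0 <= c ->
  (forall A, measurable A ->
     (\int[P]_w (psi w * \1_A (X w))%:E <= c%:E * P (X @^-1` A))%E) ->
  (\int[P]_w (psi w * g (X w))%:E <= c%:E * \int[P]_w (g (X w))%:E)%E.
Proof.
move=> mpsi psi0 mg g0 c0 hA.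
have mX : measurable_fun setT X by [].
have mEg : measurable_fun setT (EFin \o g) by exact/measurable_EFinP.
pose h := nnsfun_approx measurableT mEg.
have h0 n x : 0 <= h n x by [].
have hg n x : h n x <= g x.
  rewrite -lee_fin /h (nnsfun_approxE _ mEg).
  exact: (@le_approx _ _ _ setT (EFin \o g) n x (fun x _ => g0 x)).
have cvgh x : EFin \o h^~ x @ \oo --> (g x)%:E.
  exact: (cvg_nnsfun_approx measurableT mEg (fun x _ => g0 x)).
have mpA A : measurable A -> measurable_fun setT (fun w => psi w * \1_A (X w)).
  by move=> mA; apply: measurable_funM => //; apply: measurableT_comp => //.
have mph n : measurable_fun setT (fun w => psi w * h n (X w)).
  by apply: measurable_funM => //; exact: measurableT_comp.
have step n : (\int[P]_w (psi w * h n (X w))%:E <= c%:E * \int[P]_w (h n (X w))%:E)%E.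
  pose s := fset_set (range (h n)).
  pose A (i : nat) := h n @^-1` [set s`_i].
  have mA i : measurable (A i) by exact: measurable_sfunP.
  have s0 (i : 'I_#|`s|) : 0 <= s`_i.
    have : s`_i \in s by apply: mem_nth; exact: ltn_ord.
    rewrite in_fset_set; last exact: fimfunP.
    by move=> /set_mem[x _ <-].
  have hE x : h n x = \sum_(i < #|`s|) (s`_i * \1_(A i) x) by rewrite fimfunEord.
  have E1 : (\int[P]_w (psi w * h n (X w))%:E =
     \sum_(i < #|`s|) (s`_i)%:E * \int[P]_w (psi w * \1_(A i) (X w))%:E)%E.
    under eq_integral => w _.
      rewrite hE mulr_sumr -sumEFin.
      under eq_bigr do rewrite mulrCA EFinM.
      over.
    rewrite ge0_integral_sum//; last 2 first.
      - move=> i; apply: measurable_funeM; apply/measurable_EFinP; exact: mpA.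
      - by move=> i w _; rewrite -EFinM lee_fin mulr_ge0 ?s0// mulr_ge0//.
    apply: eq_bigr => i _; rewrite ge0_integralZl_EFin//.
    - by move=> w _; rewrite lee_fin mulr_ge0.
    - by apply/measurable_EFinP; exact: mpA.
  have E2 : (\int[P]_w (h n (X w))%:E = \sum_(i < #|`s|) (s`_i)%:E * P (X @^-1` A i))%E.
    under eq_integral => w _.
      rewrite hE -sumEFin.
      under eq_bigr do rewrite EFinM.
      over.
    rewrite ge0_integral_sum//; last 2 first.
      - move=> i; apply: measurable_funeM; apply/measurable_EFinP.
        by apply: measurableT_comp => //.
      - by move=> i w _; rewrite -EFinM lee_fin mulr_ge0 ?s0.
    apply: eq_bigr => i _; rewrite ge0_integralZl_EFin//.
    - by rewrite integral_indic_preimage.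
    - by apply/measurable_EFinP; apply: measurableT_comp.
  rewrite E1 E2 ge0_sume_distrr; last first.
    by move=> i _; rewrite mule_ge0 ?lee_fin ?s0.
  apply: lee_sum => i _; rewrite muleCA; apply: lee_wpmul2l; first by rewrite lee_fin s0.
  exact: hA.
have := @cvg_monotone_convergence _ _ _ P setT measurableT
   (fun n w => (psi w * h n (X w))%:E).
set u := fun n : nat => (\int[P]_w (psi w * h n (X w))%:E)%E.
have -> : (\int[P]_w (psi w * g (X w))%:E =
   \int[P]_w (limn (fun n => (psi w * h n (X w))%:E)))%E.
  apply: eq_integral => w _; apply/esym/cvg_lim => //.
  rewrite EFinM; under eq_fun do rewrite EFinM.
  by apply: cvgeZl => //; exact: cvgh.
move=> cv; have {}cv : u n @[n --> \oo] -->
    (\int[P]_w (limn (fun n => (psi w * h n (X w))%:E)))%E.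
  apply: cv.
  - by move=> n; apply/measurable_EFinP; exact: mph.
  - by move=> n w _; rewrite lee_fin mulr_ge0.
  - move=> w _ m n mn; rewrite lee_fin; apply: ler_wpM2l => //.
    by have /lefP := @nd_nnsfun_approx _ _ _ _ measurableT _ mEg _ _ mn; apply.
rewrite -(cvg_lim _ cv)//; apply: lime_le; first by apply/cvg_ex; eexists; exact: cv.
apply: nearW => n; apply: (le_trans (step n)); apply: lee_wpmul2l => //.
apply: ge0_le_integral => //.
- by move=> w _; rewrite lee_fin.
- by apply/measurable_EFinP; exact: measurableT_comp.
- by apply/measurable_EFinP; exact: measurableT_comp.
- by move=> w _; rewrite lee_fin.
Qed.

End Independence.

(** * Exponential moments of sub-Gaussian sums *)

Section MomentGenerating.
Context {R : realType} {d : measure_display} {T : measurableType d}.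
Variable P : probability T R.

Section Product.
Variables (n : nat) (X : 'I_n -> {RV P >-> R}) (g : 'I_n -> R -> R) (b : 'I_n -> R).
Hypothesis indep : independent_RVs X.
Hypothesis mg : forall i, measurable_fun setT (g i).
Hypothesis g0 : forall i x, 0 <= g i x.
Hypothesis b0 : forall i, 0 <= b i.
Hypothesis gb : forall i, (\int[P]_w (g i (X i w))%:E <= (b i)%:E)%E.

Let phi m (A : 'I_n -> set R) (i : 'I_n) : R -> R :=
  if (i < m)%N then g i else \1_(A i).
Let bd m (A : 'I_n -> set R) (i : 'I_n) : R :=
  if (i < m)%N then b i else fine (P (X i @^-1` A i)).

Let phi0 m A i x : 0 <= phi m A i x.
Proof. by rewrite /phi; case: ifP => // _; rewrite indicE. Qed.

Let mphi m A i : (forall i, measurable (A i)) ->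
  measurable_fun setT (fun w => phi m A i (X i w)).
Proof.
move=> mA; have mX : measurable_fun setT (X i) by [].
by rewrite /phi; case: ifP => _; apply: measurableT_comp.
Qed.

Let bd0 m A i : 0 <= bd m A i.
Proof. by rewrite /bd; case: ifP => // _; exact: fine_ge0. Qed.

(** Independence is the case where all factors are indicators; they are exchanged for the
    functions g one at a time by [le_integral_transfer]. *)
Let partial_product m : (m <= n)%N -> forall A, (forall i, measurable (A i)) ->
  (\int[P]_w (\prod_i phi m A i (X i w))%:E <= (\prod_i bd m A i)%:E)%E.
Proof.
elim: m => [_ A mA|m IH mn A mA].
  have mXA i : measurable (X i @^-1` A i) by exact: preimage_measurable.
  have mI : measurable (\bigcap_(i in [set` [set: 'I_n]%SET]) (X i @^-1` A i)).
    by apply: fin_bigcap_measurable => //; exact: finite_finset.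
  have -> : (\int[P]_w (\prod_i phi 0 A i (X i w))%:E =
      P (\bigcap_(i in [set` [set: 'I_n]%SET]) (X i @^-1` A i)))%E.
    rewrite -[in RHS](setIT (\bigcap_(_ in _) _)) -integral_indic//.
    apply: eq_integral => w _; congr EFin; rewrite /phi /= indicE.
    have [wI|/negP wI] := boolP (w \in _).
      rewrite big1// => i _; rewrite indicE mem_set//.
      by have := set_mem wI; apply => /=; rewrite finset.in_setT.
    apply/eqP; rewrite prodf_seq_eq0; apply: contrapT => /negP/hasPn h.
    apply: wI; apply/mem_set => i _.
    have := h i (mem_index_enum _); rewrite /= indicE.
    by case: (boolP (_ \in _)) => [/set_mem//|]; rewrite eqxx.
  rewrite indep// -prodEFin /bd /=.
  under eq_bigl do rewrite finset.in_setT.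
  rewrite le_eqVlt; apply/orP; left; apply/eqP; apply: eq_bigr => i _.
  by rewrite fineK// fin_num_measure.
pose o := Ordinal mn.
(* The factor o passes from an indicator to g o; all others are kept in psi. *)
pose psi w := \prod_(i | i != o) phi m.+1 A i (X i w).
pose c := \prod_(i | i != o) bd m.+1 A i.
have c0 : 0 <= c by apply: prodr_ge0 => i _; exact: bd0.
have psi0 w : 0 <= psi w by apply: prodr_ge0 => i _; exact: phi0.
have mpsi : measurable_fun setT psi.
  rewrite /psi; under eq_fun do rewrite big_mkcond.
  apply: measurable_prod => i _.
  by case: (i != o); [exact: mphi|exact: measurable_cst].
have lt_neq (i : 'I_n) : i != o -> (i < m.+1)%N = (i < m)%N.
  rewrite -val_eqE /= => io; lia.
have key := @le_integral_transfer _ _ _ P psi (X o) (g o) c mpsi psi0 (mg o) (g0 o) c0.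
have -> : (\int[P]_w (\prod_i phi m.+1 A i (X i w))%:E =
    \int[P]_w (psi w * g o (X o w))%:E)%E.
  apply: eq_integral => w _; rewrite (bigD1 o)//= mulrC /phi /psi.
  by rewrite ltnSn.
have -> : \prod_i bd m.+1 A i = c * b o by rewrite (bigD1 o)//= mulrC /bd ltnSn.
apply: (@le_trans _ _ (c%:E * \int[P]_w (g o (X o w))%:E)%E); last first.
  by rewrite EFinM; apply: lee_wpmul2l.
apply: key => B mB.
pose A' i := if i == o then B else A i.
have mA' i : measurable (A' i) by rewrite /A'; case: ifP.
have := IH (ltnW mn) A' mA'.
have -> : (\int[P]_w (\prod_i phi m A' i (X i w))%:E =
   \int[P]_w (psi w * \1_B (X o w))%:E)%E.
  apply: eq_integral => w _; rewrite (bigD1 o)//= mulrC; congr (_ * _)%:E.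
    by apply: eq_bigr => i io; rewrite /phi lt_neq// /A' (negbTE io).
  by rewrite /phi ltnn /A' eqxx.
have -> : \prod_i bd m A' i = c * fine (P (X o @^-1` B)).
  rewrite (bigD1 o)//= mulrC; congr (_ * _).
    by apply: eq_bigr => i io; rewrite /bd lt_neq// /A' (negbTE io).
  by rewrite /bd ltnn /A' eqxx.
by rewrite EFinM fineK ?fin_num_measure//; exact: preimage_measurable.
Qed.

Lemma independent_prod_le :
  (\int[P]_w (\prod_i g i (X i w))%:E <= (\prod_i b i)%:E)%E.
Proof.
have := partial_product n (leqnn n) (fun=> setT) (fun=> measurableT).
rewrite [X in (_ <= (X)%:E)%E](_ : _ = \prod_i b i); last first.
  by apply: eq_bigr => i _; rewrite /bd ltn_ord.
congr (_ <= _)%E; apply: eq_integral => w _; congr EFin.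
by apply: eq_bigr => i _; rewrite /phi ltn_ord.
Qed.

End Product.

Lemma expR_le_quadratic (x : R) : expR x <= 1 + x + x ^+ 2 * expR `|x|.
Proof.
have h1 := expR_ge1Dx x; have h2 := expR_ge1Dx (- x).
have e0 := expR_gt0 x.
have hx : expR x * expR (- x) = 1 by rewrite -expRD subrr expR0.
have [x0|x0] := leP 0 x.
  rewrite ger0_norm//.
  have h3 : expR x - 1 <= x * expR x by nra.
  have : x * (expR x - 1) <= x * (x * expR x) by apply: ler_wpM2l.
  nra.
rewrite ltr0_norm//.
have h4 : 1 <= expR (- x) by rewrite -expR0 ler_expR oppr_ge0 ltW.
have h5 : x * (expR x - 1) <= x ^+ 2 by nra.
have h6 : expR x - 1 - x <= x * (expR x - 1) by nra.
have : x ^+ 2 * 1 <= x ^+ 2 * expR (- x) by apply: ler_wpM2l => //; exact: sqr_ge0.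
nra.
Qed.

(** The term e^2 covers |X| <= 1, the other one a geometric series over the events
    m.+1 < |X|. *)
Definition exp_moment_bound (M sigma : R) : R :=
  expR 2 + 2 * (M * expR (2 + 9 * sigma ^+ 2 / 2)).

Lemma sub_gaussian_exp_moment (M sigma : R) (X : {RV P >-> R}) :
  0 < M -> 0 < sigma -> sub_gaussian_tail M sigma X ->
  (\int[P]_w (expR (2 * `|X w|))%:E <= (exp_moment_bound M sigma)%:E)%E.
Proof.
move=> M0 s0 tail.
have mX : measurable_fun setT X by [].
pose A m := [set w | m.+1%:R < `|X w| :> R].
have mA m : measurable (A m).
  rewrite [A m](_ : _ = setT `&` (fun w => `|X w|) @^-1` `]m.+1%:R, +oo[%classic).
    by apply: measurableT_comp => //; exact: measurable_itv.
  by rewrite setTI; apply/seteqP; split => w; rewrite /A /= in_itv /= andbT.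
pose f m w : \bar R := (expR (2 * m.+2%:R) * \1_(A m) w)%:E.
have f0 m w : (0 <= f m w)%E by rewrite lee_fin mulr_ge0 ?expR_ge0// indicE.
have mf m : measurable_fun setT (f m).
  by apply/measurable_EFinP; apply: measurable_funM.
have ptw w : ((expR (2 * `|X w|))%:E <= (expR 2)%:E + \sum_(m <oo) f m w)%E.
  have [X1|X1] := leP `|X w| 1.
    apply: (@le_trans _ _ (expR 2)%:E); first by rewrite lee_fin ler_expR; lra.
    by rewrite leeDl// nneseries_ge0.
  pose m := (Num.truncn `|X w|).
  have [] := andP (truncn_itv (normr_ge0 (X w))); rewrite -/m => tm tM.
  have m0 : (0 < m)%N by rewrite /m truncn_gt0 ltW.
  have [mX'|mX'] := ltP m%:R `|X w|.
    apply: (@le_trans _ _ (f m.-1 w)).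
      rewrite /f /A indicE mem_set; last by rewrite /= prednK.
      by rewrite mulr1 lee_fin ler_expR prednK// ler_wpM2l// ltW.
    apply: (@le_trans _ _ (\sum_(m <oo) f m w)%E); last by rewrite leeDr// lee_fin expR_ge0.
    by rewrite (@nneseriesD1 _ _ m.-1)//; rewrite leeDl// nneseries_ge0.
  have m2 : (1 < m)%N by rewrite -(@ltr_nat R) (lt_le_trans X1).
  apply: (@le_trans _ _ (f m.-2 w)).
    rewrite /f /A indicE mem_set.
      by rewrite mulr1 lee_fin ler_expR ler_wpM2l// prednK -?subn1 ?subn_gt0// subn1 prednK.
    by rewrite /= prednK -?subn1 ?subn_gt0// subn1 (lt_le_trans _ tm)// ltr_nat prednK.
  apply: (@le_trans _ _ (\sum_(m <oo) f m w)%E); last by rewrite leeDr// lee_fin expR_ge0.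
  by rewrite (@nneseriesD1 _ _ m.-2)//; rewrite leeDl// nneseries_ge0.
apply: (@le_trans _ _ (\int[P]_w ((expR 2)%:E + \sum_(m <oo) f m w))%E).
  apply: ge0_le_integral => //.
  - apply/measurable_EFinP; apply: measurableT_comp => //.
    by apply: measurable_funM => //; exact: measurableT_comp.
  - apply: emeasurable_funD => //; exact: ge0_emeasurable_sum.
rewrite ge0_integralD//; last 2 first.
  - by move=> w _; rewrite nneseries_ge0.
  - exact: ge0_emeasurable_sum.
rewrite integral_cst// [X in (_ * X)%E]probability_setT mule1 integral_nneseries//.
rewrite EFinD leeD2l//.
set q := M * expR _.
have q0 : 0 <= q by rewrite mulr_ge0 ?expR_ge0 ?ltW.
have fint m : (\int[P]_w f m w <= (q * 2 ^- m)%:E)%E.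
  under eq_integral do rewrite /f EFinM.
  rewrite ge0_integralZl_EFin ?expR_ge0//; last by apply/measurable_EFinP.
  rewrite integral_indic// setIT.
  apply: (@le_trans _ _ ((expR (2 * m.+2%:R))%:E * (M * expR (- (m.+1%:R ^+ 2 / (2 * sigma ^+ 2))))%:E)%E).
    by apply: lee_wpmul2l; rewrite ?lee_fin ?expR_ge0//; exact: tail.
  rewrite -EFinM lee_fin mulrCA /q -mulrA; apply: ler_wpM2l; first exact: ltW.
  have -> : 2 ^- m = expR (ln 2 * - m%:R) :> R.
    by rewrite mulrN expRN expRM_natr lnK ?posrE.
  rewrite -!expRD ler_expR.
  have l2 : ln (2 : R) <= 1.
    by have := @le_ln1Dx R 1 ltac:(lra); rewrite -[1 + 1]/2.
  (* Completing the square turns the Gaussian tail into one of order e^(- 3 m). *)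
  have sq : m.+1%:R ^+ 2 / (2 * sigma ^+ 2) =
     3 * m.+1%:R - 9 * sigma ^+ 2 / 2 + (m.+1%:R - 3 * sigma ^+ 2) ^+ 2 / (2 * sigma ^+ 2).
    by field; rewrite gt_eqF.
  have sq0 : 0 <= (m.+1%:R - 3 * sigma ^+ 2) ^+ 2 / (2 * sigma ^+ 2).
    by rewrite divr_ge0 ?sqr_ge0// mulr_ge0// sqr_ge0.
  have hq : 3 * m.+1%:R - 9 * sigma ^+ 2 / 2 <= m.+1%:R ^+ 2 / (2 * sigma ^+ 2).
    by rewrite sq lerDl.
  have hm : ln 2 * m%:R <= m%:R :> R by rewrite ler_piMl.
  move: hq; set q2 := m.+1%:R ^+ 2 / _; rewrite mulrN.
  rewrite -[m.+2%:R]natr1 -[m.+1%:R]natr1 => hq; lra.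
apply: (@le_trans _ _ (\sum_(m <oo) (q * 2 ^- m)%:E)%E).
  by apply: lee_nneseries => [m _ _|m _]; [exact: integral_ge0|exact: fint].
apply: lime_le.
  by apply: is_cvg_nneseries => m _ _; rewrite lee_fin mulr_ge0// invr_ge0 exprn_ge0.
apply: nearW => m; rewrite sumEFin lee_fin -mulr_sumr mulrC big_mkord.
by apply: ler_wpM2r => //; exact: sum_geo2_le.
Qed.

(** In e^x <= 1 + x + x^2 e^|x|, the linear term has mean zero and the remainder is
    dominated by a^2 e^(2 |X|), because |a| <= 1. *)
Lemma sub_gaussian_mgf (M sigma a : R) (X : {RV P >-> R}) :
  0 < M -> 0 < sigma -> sub_gaussian_tail M sigma X -> ('E_P[X] = 0)%E ->
  `|a| <= 1 ->
  (\int[P]_w (expR (a * X w))%:E <=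
     (expR (4 * exp_moment_bound M sigma * a ^+ 2))%:E)%E.
Proof.
move=> M0 s0 tail EX a1.
have mX : measurable_fun setT X by [].
have mE (c : R) : measurable_fun setT (fun w => (expR (c * X w))%:E).
  by apply/measurable_EFinP; apply: measurableT_comp => //; exact: measurable_funM.
have mnE : measurable_fun setT (fun w => (expR (2 * `|X w|))%:E).
  apply/measurable_EFinP; apply: measurableT_comp => //.
  by apply: measurable_funM => //; exact: measurableT_comp.
have hK := sub_gaussian_exp_moment M sigma X M0 s0 tail.
set K := exp_moment_bound M sigma in hK *.
have iE : P.-integrable setT (fun w => (expR (2 * `|X w|))%:E).
  apply/integrableP; split=> //.
  under eq_integral do rewrite gee0_abs ?lee_fin ?expR_ge0//.
  by rewrite (le_lt_trans hK)// ltry.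
have iX : P.-integrable setT (fun w => (X w)%:E).
  apply: (le_integrable measurableT _ _ iE) => //; first exact/measurable_EFinP.
  move=> w _; rewrite lee_fin [leRHS]ger0_norm ?expR_ge0//.
  by have := expR_ge1Dx (2 * `|X w|); have := normr_ge0 (X w); lra.
have ptw w : expR (a * X w) <= 1 + a * X w + 4 * a ^+ 2 * expR (2 * `|X w|).
  apply: (le_trans (expR_le_quadratic _)); rewrite lerD2l.
  have e1 : expR `|a * X w| <= expR `|X w|.
    by rewrite ler_expR normrM ler_piMl.
  have e2 : X w ^+ 2 <= 4 * expR `|X w|.
    have h := expR_ge1Dx (`|X w| / 2).
    have -> : expR `|X w| = expR (`|X w| / 2) ^+ 2.
      by rewrite expr2 -expRD; congr expR; field.
    rewrite -[X w ^+ 2]real_normK ?num_real//.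
    have := normr_ge0 (X w); nra.
  have -> : expR (2 * `|X w|) = expR `|X w| * expR `|X w|.
    by rewrite -expRD; congr expR; ring.
  rewrite exprMn.
  have a20 : 0 <= a ^+ 2 by exact: sqr_ge0.
  have ep := expR_ge0 `|X w|; have eap := expR_ge0 `|a * X w|.
  rewrite -(mulrA (a ^+ 2)) (_ : 4 * a ^+ 2 * _ =
    a ^+ 2 * (4 * expR `|X w| * expR `|X w|)); last by ring.
  by apply: ler_wpM2l => //; apply: ler_pM => //; exact: sqr_ge0.
apply: (@le_trans _ _ (\int[P]_w (1%:E + a%:E * (X w)%:E
    + (4 * a ^+ 2)%:E * (expR (2 * `|X w|))%:E))%E).
  apply: ge0_le_integral => //.
  - apply: emeasurable_funD; last exact: measurable_funeM.
    apply: emeasurable_funD => //; apply: measurable_funeM; exact/measurable_EFinP.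
  - by move=> w _; rewrite -!EFinM -!EFinD lee_fin.
have i1 : P.-integrable setT (fun=> 1%:E).
  by apply/integrableP; split=> //; rewrite integral_cst//= normr1 mul1e probability_setT ltry.
have iaX : P.-integrable setT (fun w => (a%:E * (X w)%:E)%E) by exact: integrableZl.
rewrite integralD//; last 2 first.
  - exact: integrableD.
  - exact: integrableZl.
rewrite integralD// !integralZl// integral_cst// [X in (1 * X)%E]probability_setT mul1e.
rewrite -expectation_def EX mule0 adde0.
apply: (@le_trans _ _ (1%:E + (4 * a ^+ 2)%:E * K%:E)%E).
  by rewrite leeD2l// lee_wpmul2l// lee_fin mulr_ge0// sqr_ge0.
rewrite -EFinM -EFinD lee_fin.
apply: le_trans (expR_ge1Dx _).
by rewrite mulrAC.
Qed.

Lemma linear_mgf n (X : 'I_n -> {RV P >-> R}) (M sigma : R) (a : 'I_n -> R) :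
  0 < M -> 0 < sigma -> independent_RVs X ->
  (forall i, ('E_P[X i] = 0)%E) -> (forall i, sub_gaussian_tail M sigma (X i)) ->
  \sum_i a i ^+ 2 <= 1 ->
  (\int[P]_w (expR (\sum_i X i w * a i))%:E <=
    (expR (4 * exp_moment_bound M sigma))%:E)%E.
Proof.
move=> M0 s0 indep EX tail a1.
have K0 : 0 <= exp_moment_bound M sigma.
  by rewrite /exp_moment_bound addr_ge0 ?expR_ge0// !mulr_ge0 ?expR_ge0// ltW.
under eq_integral => w _ do rewrite expR_sum.
have ai i : `|a i| <= 1.
  rewrite -ler_sqr ?nnegrE// expr1n real_normK ?num_real//.
  apply: le_trans a1; rewrite (bigD1 i)//= lerDl sumr_ge0// => j _; exact: sqr_ge0.
apply: (le_trans (independent_prod_le n X (fun i x => expR (x * a i))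
  (fun i => expR (4 * exp_moment_bound M sigma * a i ^+ 2)) indep _ _ _ _)).
- by move=> i; apply: measurableT_comp => //; apply: measurable_funM.
- by move=> i x; exact: expR_ge0.
- by move=> i; exact: expR_ge0.
- move=> i; under eq_integral do rewrite mulrC.
  exact: sub_gaussian_mgf.
rewrite -expR_sum lee_fin ler_expR -mulr_sumr.
by rewrite ler_piMr// mulr_ge0.
Qed.

End MomentGenerating.

(** * Expectation of the noise functional *)

Section NoiseExpectation.
Context {R : realType} {d : measure_display} {T : measurableType d}.
Variable P : probability T R.

Definition noise_seq n (X : 'I_n -> {RV P >-> R}) (w : T) : nat -> R :=
  fun i => if insub i is Some j then X j w else 0.

Lemma noise_seq_ord n (X : 'I_n -> {RV P >-> R}) w (i : 'I_n) :
  noise_seq n X w i = X i w.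
Proof. by rewrite /noise_seq valK. Qed.

Lemma measurable_linear n (X : 'I_n -> {RV P >-> R}) (a : 'I_n -> R) :
  measurable_fun setT (fun w => \sum_i X i w * a i).
Proof.
apply: measurable_sum => i.
have mX : measurable_fun setT (X i) by [].
exact: measurable_funM.
Qed.

(** 4 ^ r is the growth of the number of cells, 2 ^ r the Young parameter of level r;
    e^4 >= 16 beats both. *)
Lemma scale_weight_le (r : nat) : 2 ^+ r * expR (- (4 * r%:R)) * 4 ^+ r <= 2 ^- r :> R.
Proof.
have -> : expR (- (4 * r%:R)) = expR (- 4) ^+ r :> R.
  by rewrite -expRM_natr mulNr.
have e4 : expR (- 4) <= 16^-1 :> R.
  have e1 : 2 <= expR 1 :> R by have := @expR_ge1Dx R 1; lra.
  rewrite expRN lef_pV2 ?posrE ?expR_gt0//.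
  have -> : expR 4 = expR 1 ^+ 4 :> R by rewrite -expRM_natr mul1r.
  have -> : 16 = 2 ^+ 4 :> R by rewrite -natrX.
  by apply: lerXn2r => //; rewrite nnegrE// expR_ge0.
have e0 := expR_ge0 (- 4 : R).
have h0 : 0 <= 2 * expR (- 4) * 4 :> R by lra.
have h : 2 * expR (- 4) * 4 <= 2^-1 :> R by lra.
by rewrite -!exprMn -exprVn; apply: lerXn2r; rewrite ?nnegrE.
Qed.

Lemma noise_functional_ge0 n K N0 s0 (phi : nat -> nat -> nat -> nat -> R) e :
  0 <= noise_functional n K N0 s0 phi e.
Proof.
apply: sumr_ge0 => r _; apply: mulr_ge0.
  by rewrite mulr_ge0 ?expR_ge0 ?exprn_ge0.
by apply: sumr_ge0 => l _; apply: sumr_ge0 => q _; rewrite addr_ge0 ?expR_ge0.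
Qed.

Variables (n : nat) (X : 'I_n -> {RV P >-> R}) (M sigma : R).
Hypotheses (M0 : 0 < M) (s0 : 0 < sigma) (indep : independent_RVs X).
Hypothesis EX : forall i, ('E_P[X i] = 0)%E.
Hypothesis tail : forall i, sub_gaussian_tail M sigma (X i).

Lemma measurable_noise_functional K N0 S (phi : nat -> nat -> nat -> nat -> R) :
  measurable_fun setT (fun w => noise_functional n K N0 S phi (noise_seq n X w)).
Proof.
apply: measurable_sum => r; apply: measurable_funM => //.
apply: measurable_sum => l; apply: measurable_sum => q.
have mL : measurable_fun setT (fun w => \sum_(i < n) noise_seq n X w i * phi r l q i).
  under eq_fun do under eq_bigr do rewrite noise_seq_ord.
  exact: measurable_linear.
apply: measurable_funD; apply: measurableT_comp => //.
exact: measurable_funN.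
Qed.

Lemma expectation_noise_functional_le K N0 S (phi : nat -> nat -> nat -> nat -> R) :
  (forall r l q, (q < K)%N -> \sum_(i < n) phi r l q i ^+ 2 <= 1) ->
  (\int[P]_w (noise_functional n K N0 S phi (noise_seq n X w))%:E
    <= (4 * K%:R * expR (4 * exp_moment_bound M sigma) * N0%:R)%:E)%E.
Proof.
move=> phi1; set E := expR (4 * _).
pose Z r l q w : R := \sum_(i < n) noise_seq n X w i * phi r l q i.
have ZE r l q w : Z r l q w = \sum_i X i w * phi r l q i.
  by apply: eq_bigr => i _; rewrite noise_seq_ord.
have NZE r l q w : - Z r l q w = \sum_i X i w * - phi r l q i.
  by rewrite ZE -sumrN; apply: eq_bigr => i _; rewrite mulrN.
have mZ r l q : measurable_fun setT (Z r l q).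
  rewrite (_ : Z r l q = fun w => \sum_i X i w * phi r l q i); last by apply/funext => w; exact: ZE.
  exact: measurable_linear.
have mexp r l q : measurable_fun setT (fun w => (expR (Z r l q w))%:E).
  by apply/measurable_EFinP; exact: measurableT_comp.
have mexpN r l q : measurable_fun setT (fun w => (expR (- Z r l q w))%:E).
  by apply/measurable_EFinP; apply: measurableT_comp => //; exact: measurable_funN.
have bound r l q : (q < K)%N ->
   (\int[P]_w ((expR (Z r l q w))%:E + (expR (- Z r l q w))%:E) <= (2 * E)%:E)%E.
  move=> qK; rewrite ge0_integralD//.
  rewrite (_ : 2 * E = E + E); last by ring.
  rewrite EFinD; apply: leeD.
    under eq_integral do rewrite ZE.
    by apply: (linear_mgf P n X M sigma); rewrite ?phi1.
  under eq_integral do rewrite NZE.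
  apply: (linear_mgf P n X M sigma) => //.
  by under eq_bigr do rewrite sqrrN; exact: phi1.
pose c r : R := 2 ^+ r * expR (- (4 * r%:R)).
have c0 r : 0 <= c r by rewrite mulr_ge0 ?expR_ge0 ?exprn_ge0.
have -> : (\int[P]_w (noise_functional n K N0 S phi (noise_seq n X w))%:E =
   \sum_(r < S.+1) \sum_(l < N0 * 4 ^ r) \sum_(q < K)
     (c r)%:E * \int[P]_w ((expR (Z r l q w))%:E + (expR (- Z r l q w))%:E))%E.
  have mterm r l q : measurable_fun setT (fun w =>
      ((c r)%:E * ((expR (Z r l q w))%:E + (expR (- Z r l q w))%:E))%E).
    by apply: measurable_funeM; exact: emeasurable_funD.
  have pos r l q w : (0 <= (c r)%:E * ((expR (Z r l q w))%:E + (expR (- Z r l q w))%:E))%E.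
    by rewrite -EFinD -EFinM lee_fin mulr_ge0// addr_ge0// expR_ge0.
  transitivity (\int[P]_w (\sum_(r < S.+1) \sum_(l < N0 * 4 ^ r) \sum_(q < K)
     (c r)%:E * ((expR (Z r l q w))%:E + (expR (- Z r l q w))%:E)))%E.
    apply: eq_integral => w _; rewrite /noise_functional -sumEFin.
    apply: eq_bigr => r _; rewrite mulr_sumr -sumEFin.
    apply: eq_bigr => l _; rewrite mulr_sumr -sumEFin.
    by apply: eq_bigr => q _; rewrite EFinM EFinD.
  rewrite ge0_integral_sum//; last 2 first.
  - by move=> r; apply: emeasurable_sum => l; apply: emeasurable_sum => q; exact: mterm.
  - by move=> r w _; apply: sume_ge0 => l _; apply: sume_ge0 => q _; exact: pos.
  apply: eq_bigr => r _; rewrite ge0_integral_sum//; last 2 first.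
  - by move=> l; apply: emeasurable_sum => q; exact: mterm.
  - by move=> l w _; apply: sume_ge0 => q _; exact: pos.
  apply: eq_bigr => l _; rewrite ge0_integral_sum//.
  apply: eq_bigr => q _; rewrite ge0_integralZl_EFin//.
  - by move=> w _; rewrite -EFinD lee_fin addr_ge0// expR_ge0.
  - exact: emeasurable_funD.
apply: (@le_trans _ _ (\sum_(r < S.+1) \sum_(l < N0 * 4 ^ r) \sum_(q < K)
     ((c r)%:E * (2 * E)%:E))%E).
  apply: lee_sum => r _; apply: lee_sum => l _; apply: lee_sum => q _.
  by apply: lee_wpmul2l; [rewrite lee_fin|exact: bound].
under eq_bigr do under eq_bigr do under eq_bigr do rewrite -EFinM.
under eq_bigr do under eq_bigr do rewrite sumEFin.
under eq_bigr do rewrite sumEFin.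
rewrite sumEFin lee_fin.
apply: (@le_trans _ _ (\sum_(r < S.+1) (2 * K%:R * E * N0%:R) * 2 ^- r)).
  apply: ler_sum => r _; rewrite !sumr_const !card_ord.
  rewrite -[leLHS]mulr_natl -[_ *+ K]mulr_natl natrM natrX.
  have -> : N0%:R * 4 ^+ r * (K%:R * (c r * (2 * E))) =
     (2 * K%:R * E * N0%:R) * (c r * 4 ^+ r) by ring.
  apply: ler_wpM2l; last exact: scale_weight_le.
  by rewrite !mulr_ge0 ?expR_ge0.
rewrite -mulr_sumr.
apply: (@le_trans _ _ ((2 * K%:R * E * N0%:R) * 2)).
  apply: ler_wpM2l; last exact: sum_geo2_le.
  by rewrite !mulr_ge0 ?expR_ge0.
by rewrite le_eqVlt; apply/orP; left; apply/eqP; ring.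
Qed.

Lemma markov_strict_tail (Y : T -> R) (c : R) : measurable_fun setT Y ->
  (forall w, 0 <= Y w) -> 0 <= c ->
  (c%:E * P [set w | c < Y w]%R <= \int[P]_w (Y w)%:E)%E.
Proof.
move=> mY Y0 c0; set A := [set w | _].
have mA : measurable A.
  rewrite (_ : A = setT `&` Y @^-1` `]c, +oo[%classic).
    by apply: mY => //; exact: measurable_itv.
  by rewrite setTI; apply/seteqP; split => w; rewrite /A /= in_itv /= andbT.
have := @integral_indic _ _ _ P setT measurableT A mA.
rewrite setIT => <-; rewrite -ge0_integralZl_EFin//; last by apply/measurable_EFinP.
apply: ge0_le_integral => //.
- by move=> w _; rewrite mule_ge0// lee_fin.
- by apply: measurable_funeM; apply/measurable_EFinP.
- by apply/measurable_EFinP.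
- move=> w _; rewrite -EFinM lee_fin indicE.
  by have [/set_mem/ltW|_] := boolP (w \in A); rewrite ?mulr1 ?mulr0.
Qed.

End NoiseExpectation.

(** * Measurability of the error events *)

Section Error.
Context {R : realType} {d : measure_display} {T : measurableType d}.
Variable P : probability T R.

Lemma avg_sq_error_ge0 n (b : 'cV[R]_n) (f : R -> R) : 0 <= avg_sq_error b f.
Proof. by rewrite mulr_ge0 ?invr_ge0// sumr_ge0// => i _; exact: sqr_ge0. Qed.

(** The estimate is not assumed to be measurable.  Being Lipschitz in the data, it turns
    the event into an open condition on the noise variables. *)
Lemma measurable_error_event n k (lambda : R) (f : R -> R)
    (X : 'I_n -> {RV P >-> R}) (b : T -> 'cV[R]_n) (c : R) :
  (0 < n)%N -> 0 <= lambda ->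
  (forall w, is_trend_filter k lambda (samples f (fun i => X i w)) (b w)) ->
  measurable [set w | c < avg_sq_error (b w) f].
Proof.
move=> n0 l0 tf.
have nR0 : 0 < n%:R :> R by rewrite ltr0n.
apply: (measurable_open_condition n (fun i => X i)) => [//|w hw].
pose H w := \sum_(i < n) (b w i ord0 - f (design i)) ^+ 2.
have HE w' : avg_sq_error (b w') f = H w' / n%:R by rewrite /avg_sq_error mulrC.
have H0 w' : 0 <= H w' by apply: sumr_ge0 => i _; exact: sqr_ge0.
have [c0|c0] := ltP c 0.
  exists 1 => // w' _ /=; exact: lt_le_trans c0 (avg_sq_error_ge0 _ _ _).
have gap : 0 < H w - c * n%:R.
  by rewrite subr_gt0 -ltr_pdivlMr// -HE.
set g := H w - c * n%:R in gap.
(* By (u + v)^2 >= (1 - tau) u^2 - v^2 / tau, a perturbation of the noise costs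
   tau H w, at most half the gap, and D / tau, made at most a quarter by e. *)
pose tau := g / (2 * (H w + 1)).
have H1 : 0 < 2 * (H w + 1) by have := H0 w; lra.
have tau0 : 0 < tau by rewrite divr_gt0.
have tauE : tau * (2 * (H w + 1)) = g by rewrite /tau divfK// gt_eqF.
pose e := Num.min 1 (g * tau / (16 * n%:R)).
have q0 : 0 < g * tau / (16 * n%:R) by apply: divr_gt0; apply: mulr_gt0 => //; rewrite ltr0n.
have e0 : 0 < e by rewrite lt_min ltr01.
have e1 : e <= 1 by rewrite ge_min lexx.
have e2 : e * (16 * n%:R) <= g * tau.
  by rewrite -ler_pdivlMr ?mulr_gt0// ge_min lexx orbT.
exists e => // w' hw'.
rewrite /= HE ltr_pdivlMr//.
pose D := \sum_(i < n) (b w' i ord0 - b w i ord0) ^+ 2.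
have D0 : 0 <= D by apply: sumr_ge0 => i _; exact: sqr_ge0.
have D1 : D <= 4 * (n%:R * e).
  apply: (le_trans (trend_filter_lipschitz n k lambda _ _ _ _ l0 (tf w) (tf w'))).
  apply: ler_wpM2l => //.
  apply: (@le_trans _ _ (\sum_(i < n) e)); last by rewrite sumr_const card_ord mulr_natl.
  apply: ler_sum => i _; rewrite !mxE.
  rewrite (_ : f (design i) + X i w' - (f (design i) + X i w) = X i w' - X i w); last by ring.
  rewrite -real_normK ?num_real// expr2.
  apply: (@le_trans _ _ (e * 1)); last by rewrite mulr1.
  by apply: ler_pM => //; [exact: ltW|apply: ltW; exact: lt_le_trans e1].
have D2 : D / tau <= g / 4.
  rewrite ler_pdivrMr//; lra.
have HH : (1 - tau) * H w - D / tau <= H w'.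
  rewrite mulr_sumr mulr_suml -sumrB; apply: ler_sum => i _.
  set u := b w i ord0 - f (design i).
  have -> : b w' i ord0 - f (design i) = u + (b w' i ord0 - b w i ord0).
    by rewrite /u; ring.
  set v := b w' i ord0 - b w i ord0.
  rewrite -subr_ge0.
  have tn0 : tau != 0 by rewrite gt_eqF.
  have -> : (u + v) ^+ 2 - ((1 - tau) * u ^+ 2 - v ^+ 2 / tau) =
     v ^+ 2 + (tau * u + v) ^+ 2 / tau by field.
  by rewrite addr_ge0 ?sqr_ge0// divr_ge0 ?sqr_ge0// ltW.
apply: lt_le_trans HH.
have tH : tau * H w <= g / 2 by have := H0 w; nra.
have gE : g = H w - c * n%:R by [].
rewrite [(1 - tau) * _]mulrBl mul1r; move: D2 gE gap tH.
set x := D / tau; set y := tau * H w; clearbody x y; lra.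
Qed.

End Error.

(** * Choice of the coarsest scale *)

Section Scales.
Context {R : realType}.

Lemma exists_scale (b : nat) (y : R) : (1 < b)%N -> 1 <= y ->
  exists s : nat, b%:R ^+ s <= y < b%:R ^+ s.+1.
Proof.
move=> b1 y1; pose t := Num.truncn y.
have y0 : 0 <= y by apply: le_trans y1.
have /andP[ty yt] := truncn_itv y0.
have t0 : (0 < t)%N by rewrite truncn_gt0.
have /andP[h1 h2] := trunc_log_bounds b1 t0.
exists (trunc_log b t); apply/andP; split.
  by apply: le_trans ty; rewrite -natrX ler_nat.
by apply: lt_le_trans yt _; rewrite -natrX ler_nat.
Qed.

(** 2 ^ s is the largest power of 2 below kappa rho ^ k.+1, and by maximality
    n / 4 ^ s is at most 4 rho / kappa ^ 2; 4 ^ L exceeds n by a factor at most 4. *)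
Lemma scale_choice (k n : nat) (rho kappa : R) :
  1 <= rho -> rho ^+ (2 * k + 3) = n%:R -> 0 < kappa <= 1 ->
  1 <= kappa * rho ^+ k.+1 ->
  exists L s : nat, [/\ (n <= 4 ^ L)%N, (s <= L)%N, 2 ^+ s <= kappa * rho ^+ k.+1 &
    (4 ^ (L - s))%:R <= 16 * rho / kappa ^+ 2].
Proof.
move=> rho1; rewrite (_ : 2 * k + 3 = (k.+1 * 2).+1)%N; last by lia.
move=> rhon /andP[k0 k1] big.
have rho0 : 0 < rho by apply: lt_le_trans rho1.
have n1 : 1 <= n%:R :> R by rewrite -rhon exprn_ege1.
have [t /andP[t1 t2]] := exists_scale 4 n%:R isT n1.
have [s /andP[s1 s2]] := exists_scale 2 _ isT big.
exists t.+1, s.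
have s4 : 4 ^+ s <= n%:R :> R.
  have -> : 4 = 2 ^+ 2 :> R by rewrite -natrX.
  rewrite -exprM mulnC exprM -rhon.
  apply: (@le_trans _ _ ((rho ^+ k.+1) ^+ 2)).
    apply: lerXn2r; rewrite ?nnegrE ?exprn_ge0// ?(ltW rho0)//.
    by apply: (le_trans s1); rewrite ler_piMl// exprn_ge0// ltW.
  by rewrite -exprM; apply: ler_weXn2l.
have st : (s <= t.+1)%N.
  rewrite -(@ler_eXn2l R 4) ?ltr1n//.
  exact: le_trans s4 (ltW t2).
split => //.
  by rewrite -(ler_nat R) natrX; exact: ltW.
rewrite natrX.
have -> : 4 ^+ (t.+1 - s) = 4 ^+ t.+1 / 4 ^+ s :> R.
  by rewrite -{2}(subnK st) exprD mulfK// expf_neq0.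
rewrite ler_pdivrMr ?exprn_gt0//.
apply: (@le_trans _ _ (4 * n%:R)).
  by rewrite exprS ler_wpM2l.
have k2 : 0 < kappa ^+ 2 by rewrite exprn_gt0.
rewrite -(ler_pM2r k2) -!mulrA [_^-1 * _]mulrCA mulVf ?gt_eqF// mulr1.
have h : (kappa * rho ^+ k.+1) ^+ 2 <= 4 * 4 ^+ s.
  have -> : 4 * 4 ^+ s = (2 ^+ s.+1) ^+ 2 :> R.
    rewrite -exprM mulnC exprM -exprS; congr (_ ^+ _); by rewrite -natrX.
  by apply: lerXn2r; rewrite ?nnegrE ?exprn_ge0 ?mulr_ge0 ?exprn_ge0 ?(ltW k0) ?(ltW rho0) ?ltW.
rewrite exprMn in h.
have -> : n%:R = rho * (rho ^+ k.+1) ^+ 2.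
  by rewrite -rhon exprS exprM.
have := ler_wpM2l (ltW rho0) h.
set a := (rho ^+ k.+1) ^+ 2; nra.
Qed.

End Scales.

(** * Error bound at a fixed sample size *)

Section ErrorBound.
Context {R : realType} {d : measure_display} {T : measurableType d}.
Variable P : probability T R.

(** The penalty level n ^ k lambda / k! is at least (c1 / k!) (rho ^ k.+1) ^ (2 k + 1),
    because n ^ k rho = (rho ^ k.+1) ^ (2 k + 1).  The factor B of the noise bound is at
    most 64 (k + 1) kappa times the same power, and the smallness of kappa makes it
    smaller than the penalty level. *)
Lemma trend_filter_error_bound (k n : nat) (C M sigma rho lambda c1 c2 kappa : R)
    (f : R -> R) (X : 'I_n -> {RV P >-> R}) (b : T -> 'cV[R]_n) :
  0 < M -> 0 < sigma -> independent_RVs X ->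
  (forall i, ('E_P[X i] = 0)%E) -> (forall i, sub_gaussian_tail M sigma (X i)) ->
  0 <= C -> in_class k C f ->
  (forall w, is_trend_filter k lambda (samples f (fun i => X i w)) (b w)) ->
  1 <= rho -> rho ^+ (2 * k + 3) = n%:R -> 0 < kappa <= 1 ->
  1 <= kappa * rho ^+ k.+1 ->
  c1 * rho <= lambda <= c2 * rho -> 0 <= c1 ->
  64 * k.+1%:R * kappa <= c1 / k`!%:R ->
  exists W : T -> R, [/\ measurable_fun setT W, forall w, 0 <= W w,
    (\int[P]_w (W w)%:E <=
      (4 * k.+1%:R * expR (4 * exp_moment_bound M sigma) * (16 / kappa ^+ 2) * rho)%:E)%E &
    forall w, \sum_(i < n) (b w i ord0 - f (design i)) ^+ 2 <=
      8 / 3 * (16 * W w + 4 * k.+2%:R ^+ 2 * C * c2 * rho)].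
Proof.
move=> M0 s0 indep EX tail C0 fC tf rho1 rhon kap big /andP[l1 l2] c10 hkap.
have [L [s [nL sL s2 N0]]] := scale_choice k n rho kappa rho1 rhon kap big.
have [k0 k1] := andP kap.
have rho0 : 0 < rho by apply: lt_le_trans rho1.
have [phi [phi1 hphi]] := @noise_inner_product_le R n k L s nL sL.
exists (fun w => noise_functional n k.+1 (4 ^ (L - s)) s phi (noise_seq P n X w)).
have fact0 : 0 < k`!%:R :> R by rewrite ltr0n fact_gt0.
split.
- exact: measurable_noise_functional.
- by move=> w; exact: noise_functional_ge0.
- apply: (le_trans (expectation_noise_functional_le P n X M sigma M0 s0 indep EX tail _ _ _ _ phi1)).
  rewrite lee_fin -[leRHS]mulrA; apply: ler_wpM2l.
    by rewrite !mulr_ge0 ?expR_ge0.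
  by apply: (le_trans N0); rewrite mulrAC.
move=> w.
pose B : R := 64 * k.+1%:R * (2 ^+ s) ^+ (2 * k + 1).
have B0 : 0 <= B by rewrite !mulr_ge0 ?exprn_ge0.
pose La : R := n%:R ^+ k / k`!%:R * lambda.
have rhoE : n%:R ^+ k * rho = (rho ^+ k.+1) ^+ (2 * k + 1).
  rewrite -rhon -exprM -exprSr -exprM; congr (_ ^+ _).
  clear; nia.
have BLa : B <= La.
  apply: (@le_trans _ _ (64 * k.+1%:R * (kappa * (rho ^+ k.+1) ^+ (2 * k + 1)))).
    rewrite /B; apply: ler_wpM2l; first by rewrite mulr_ge0.
    apply: (@le_trans _ _ ((kappa * rho ^+ k.+1) ^+ (2 * k + 1))).
      by apply: lerXn2r => //; rewrite nnegrE ?exprn_ge0// mulr_ge0 ?exprn_ge0// ltW.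
    rewrite exprMn; apply: ler_wpM2r; first by rewrite !exprn_ge0// ltW.
    by rewrite addn1 exprS ler_piMr ?(ltW k0)// exprn_ile1// ltW.
  rewrite mulrA -rhoE.
  apply: (@le_trans _ _ (c1 / k`!%:R * (n%:R ^+ k * rho))).
    by apply: ler_wpM2r => //; rewrite mulr_ge0 ?exprn_ge0// ltW.
  have -> : c1 / k`!%:R * (n%:R ^+ k * rho) = n%:R ^+ k / k`!%:R * (c1 * rho) by ring.
  by apply: ler_wpM2l => //; rewrite divr_ge0 ?exprn_ge0.
pose S : R := \sum_(j < n - k.+1) `|iter k.+1 fdiff (fun i => f (i.+1%:R / n%:R)) j|.
have S0 : 0 <= S by exact: sumr_ge0.
have hS : n%:R ^+ k * S <= 2 * k.+2%:R ^+ 2 * C := class_diff_sum_le k C f fC C0 n.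
have LaS : La * S <= 2 * k.+2%:R ^+ 2 * C * c2 * rho.
  have lam0 : 0 <= lambda by apply: le_trans l1; rewrite mulr_ge0// ltW.
  have -> : La * S = (n%:R ^+ k * S) * (lambda / k`!%:R) by rewrite /La; ring.
  rewrite -[leRHS]mulrA; apply: ler_pM => //.
  - by rewrite mulr_ge0// exprn_ge0.
  - by rewrite divr_ge0// ltW.
  apply: le_trans l2; rewrite ler_pdivrMr// ler_peMr//.
  by rewrite ler1n fact_gt0.
have := trend_filter_basic n k lambda f (fun i => X i w) (b w) B
  (16 * noise_functional n k.+1 (4 ^ (L - s)) s phi (noise_seq P n X w)) (tf w) BLa.
move=> /(_ _ B0) h; apply: le_trans (h _) _ => [g|].
  have := hphi (noise_seq P n X w) (extend g).
  rewrite -/B.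
  congr (_ <= _).
    by apply: eq_bigr => i _; rewrite noise_seq_ord extend_ord.
  by congr (_ + _ / _ + _); apply: eq_bigr => i _; rewrite extend_ord.
rewrite -/La -/S; apply: ler_wpM2l => //; rewrite lerD2l.
have -> : 4 * k.+2%:R ^+ 2 * C * c2 * rho = 2 * (2 * k.+2%:R ^+ 2 * C * c2 * rho) by ring.
by rewrite -mulrA ler_wpM2l.
Qed.

End ErrorBound.

Section Rates.
Context {R : realType}.

Lemma powR_root (k n : nat) :
  (n%:R `^ (2 * k + 3)%:R^-1 : R) ^+ (2 * k + 3) = n%:R.
Proof.
have k0 : (2 * k + 3)%:R != 0 :> R by rewrite pnatr_eq0 addn3.
by rewrite -powR_mulrn ?powR_ge0// -powRrM mulVf// powRr1.
Qed.

Lemma minimax_rateE (k n : nat) : (0 < n)%N ->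
  minimax_rate k n = n%:R `^ (2 * k + 3)%:R^-1 / n%:R :> R.
Proof.
move=> n0; have nn0 : n%:R != 0 :> R by rewrite pnatr_eq0 -lt0n.
have k0 : (2 * k + 3)%:R != 0 :> R by rewrite pnatr_eq0 addn3.
rewrite /minimax_rate -[X in _ = _ / X]powRr1// -powRN -powRD; last by rewrite nn0 implybT.
congr (_ `^ _).
have -> : (2 * k + 3)%:R = (2 * k + 2)%:R + 1 :> R by rewrite natr1 -addnS.
by field; move: k0; rewrite -natr1 addn3 -natr1.
Qed.

Lemma powR_root_ge (k n : nat) (c : R) : 0 <= c -> c ^+ (2 * k + 3) <= n%:R ->
  c <= n%:R `^ (2 * k + 3)%:R^-1.
Proof.
move=> c0 h; rewrite -(@ler_pXn2r _ (2 * k + 3)) ?nnegrE ?powR_ge0//.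
  by rewrite powR_root.
by rewrite addn3.
Qed.

End Rates.

(** * Rate of convergence *)

Section Convergence.
Context {R : realType} {d : nat -> measure_display} {T : forall n, measurableType (d n)}.
Variable P : forall n, probability (T n) R.

Lemma probability_le n (A B : set (T n)) : measurable A -> measurable B ->
  A `<=` B -> (P n A <= P n B)%E.
Proof. by move=> mA mB AB; apply: le_measure; rewrite ?inE. Qed.

Lemma ratio_event n (A : T n -> R) (K b : R) : 0 < b -> (forall w, 0 <= A w) ->
  [set w | K < `|A w / b|] = [set w | K * b < A w].
Proof.
move=> b0 A0; apply/seteqP; split => w /=;
by rewrite ger0_norm ?divr_ge0 ?(ltW b0)// ltr_pdivlMr.
Qed.

Lemma bigO_P_cvg0 (A : forall n, T n -> R) (B : nat -> R) :
  (forall n c, (0 < n)%N -> measurable [set w | c < A n w]) ->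
  (forall n w, 0 <= A n w) -> (forall n, (0 < n)%N -> 0 < B n) ->
  B n @[n --> \oo] --> (0 : R) ->
  bigO_P P A B -> cvg0_P P A.
Proof.
move=> mA A0 B0 cB hO delta delta0.
have nA n : [set w | delta < `|A n w|] = [set w | delta < A n w].
  by apply/seteqP; split => w /=; rewrite ger0_norm.
under eq_fun do rewrite nA.
apply/fine_cvgP; split.
  near=> n; apply: fin_num_measure; apply: mA; near: n; exact: nbhs_infty_gt.
apply/cvgrPdist_le => e e0; have [K hK] := hO e e0.
have K1 : 0 < delta / (`|K| + 1) by rewrite divr_gt0// ltr_wpDl.
near=> n.
have n0 : (0 < n)%N by near: n; exact: nbhs_infty_gt.
have Bn := B0 n n0.
have BK : B n * (`|K| + 1) <= delta.
  rewrite -ler_pdivlMr ?ltr_wpDl//; apply: (le_trans (ler_norm _)).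
  rewrite -[B n]opprK normrN -[X in `|X|]add0r.
  near: n; move/cvgrPdist_le : cB => /(_ _ K1); exact.
have KB : K * B n <= delta.
  apply: le_trans BK; rewrite mulrC; apply: ler_wpM2l; first exact: ltW.
  by rewrite (le_trans (ler_norm K))// lerDl.
have Pe : (P n [set w | K < `|A n w / B n|]%R <= e%:E)%E by near: n.
rewrite ratio_event// in Pe.
rewrite sub0r normrN ger0_norm; last exact: fine_ge0.
rewrite -lee_fin fineK; last by apply: fin_num_measure; exact: mA.
apply: le_trans Pe; apply: probability_le; [exact: mA|exact: mA|].
by move=> w /=; apply: le_lt_trans.
Unshelve. all: by end_near. Qed.

End Convergence.

Theorem corollary1
  (R : realType) (k : nat) (C M sigma : R)
  (hC : 0 < C) (hM : 0 < M) (hsigma : 0 < sigma)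
  (f0 : R -> R) (hf0 : in_class k C f0)
  (d : nat -> measure_display) (T : forall n : nat, measurableType (d n))
  (P : forall n : nat, probability (T n) R)
  (eps : forall n : nat, 'I_n -> {RV (P n) >-> R})
  (heps_iid : forall n : nat, iid (eps n))
  (heps_mean : forall (n : nat) (i : 'I_n), ('E_(P n)[eps n i] = 0)%E)
  (heps_tail : forall (n : nat) (i : 'I_n), sub_gaussian_tail M sigma (eps n i))
  (lambda : nat -> R) (hlambda0 : forall n : nat, 0 <= lambda n)
  (hlambda : theta lambda (fun n : nat => n%:R `^ ((2 * k + 3)%:R)^-1))
  (betahat : forall n : nat, T n -> 'cV[R]_n)
  (hbetahat : forall (n : nat) (w : T n),
     is_trend_filter k (lambda n) (samples f0 (fun i => eps n i w)) (betahat n w)) :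
  bigO_P P (fun n w => avg_sq_error (betahat n w) f0) (minimax_rate k) /\
  cvg0_P P (fun n w => avg_sq_error (betahat n w) f0).
Proof.
pose rho (n : nat) : R := n%:R `^ (2 * k + 3)%:R^-1.
have rho0 n : 0 <= rho n by exact: powR_ge0.
have mE n c : (0 < n)%N -> measurable [set w | c < avg_sq_error (betahat n w) f0].
  by move=> n0; apply: (measurable_error_event (P n) n k (lambda n) f0 (eps n)).
have fact0 : 0 < k`!%:R :> R by rewrite ltr0n fact_gt0.
have [/eqO_exP[c2 [c20 hc2]] /eqO_exP[c1' [c10' hc1']]] := hlambda.
(* kappa only depends on k and on the lower constant of lambda. *)
pose c1 := c1'^-1; have c10 : 0 < c1 by rewrite invr_gt0.
pose kappa : R := Num.min 1 (c1 / k`!%:R / (64 * k.+1%:R)).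
have kap0 : 0 < kappa.
  by rewrite lt_min ltr01 divr_gt0 ?divr_gt0// mulr_gt0// ltr0n.
have kap1 : kappa <= 1 by rewrite ge_min lexx.
have kapc : 64 * k.+1%:R * kappa <= c1 / k`!%:R.
  by rewrite mulrC -ler_pdivlMr ?mulr_gt0 ?ltr0n// ge_min lexx orbT.
pose c3 : R := 4 * k.+1%:R * expR (4 * exp_moment_bound M sigma) * (16 / kappa ^+ 2).
have c30 : 0 < c3.
  by rewrite !mulr_gt0 ?expR_gt0 ?ltr0n// invr_gt0 exprn_gt0.
have rate n : (0 < n)%N -> minimax_rate k n = rho n / n%:R by exact: minimax_rateE.
have rate0 n : (0 < n)%N -> 0 < minimax_rate k n :> R.
  by move=> n0; rewrite powR_gt0// ltr0n.
have bO : bigO_P P (fun n w => avg_sq_error (betahat n w) f0) (minimax_rate k).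
  move=> eta eta0; pose t := c3 / eta.
  have t0 : 0 < t by rewrite divr_gt0.
  exists (8 / 3 * (16 * t + 4 * k.+2%:R ^+ 2 * C * c2)).
  near=> n.
  have n0 : (0 < n)%N by near: n; exact: nbhs_infty_gt.
  have nR0 : 0 < n%:R :> R by rewrite ltr0n.
  have rho_gt0 : 0 < rho n by rewrite powR_gt0.
  have rho1 : 1 <= rho n.
    by apply: powR_root_ge => //; rewrite expr1n ler1n.
  have rhok : kappa^-1 <= rho n.
    apply: powR_root_ge; first by rewrite invr_ge0 ltW.
    near: n; exact: nbhs_infty_ger.
  have big : 1 <= kappa * rho n ^+ k.+1.
    rewrite mulrC -ler_pdivrMr// mul1r (le_trans rhok)// exprS ler_peMr//.
    exact: exprn_ege1.
  have lam : c1 * rho n <= lambda n <= c2 * rho n.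
    apply/andP; split.
      rewrite mulrC ler_pdivrMr// mulrC -[rho n]ger0_norm// -[lambda n]ger0_norm//.
      near: n; exact: hc1'.
    rewrite -[rho n]ger0_norm// -[lambda n]ger0_norm//.
    near: n; exact: hc2.
  have [W [mW W0 EW hW]] := @trend_filter_error_bound R (d n) (T n) (P n) k n C M sigma
    (rho n) (lambda n) c1 c2 kappa f0 (eps n) (betahat n) hM hsigma (heps_iid n).1
    (heps_mean n) (heps_tail n) (ltW hC) hf0 (hbetahat n) rho1 (powR_root k n)
    (introT andP (conj kap0 kap1)) big lam (ltW c10) kapc.
  rewrite ratio_event; [|exact: rate0|by move=> w; exact: avg_sq_error_ge0].
  have mWt : measurable [set w | t * rho n < W w].
    rewrite (_ : [set w | _] = setT `&` W @^-1` `]t * rho n, +oo[%classic).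
      by apply: mW => //; exact: measurable_itv.
    by rewrite setTI; apply/seteqP; split => w; rewrite /= in_itv /= andbT.
  apply: (@le_trans _ _ (P n [set w | t * rho n < W w]%R)).
    apply: probability_le => //; first exact: mE.
    move=> w /=; apply: contraTT; rewrite -!leNgt => Ww.
    rewrite rate// /avg_sq_error mulrC mulrA ler_pM2r ?invr_gt0//.
    apply: (le_trans (hW w)); rewrite -[leRHS]mulrA; apply: ler_wpM2l => //.
    by rewrite [leRHS]mulrDl lerD// -[leRHS]mulrA; apply: ler_wpM2l.
  have tr0 : 0 < t * rho n by rewrite mulr_gt0.
  have := markov_strict_tail (P n) W (t * rho n) mW W0 (ltW tr0).
  move=> /le_trans /(_ EW).
  have fW : P n [set w | t * rho n < W w]%R \is a fin_num by exact: fin_num_measure.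
  rewrite -(fineK fW) -EFinM !lee_fin -/c3.
  have -> : c3 * rho n = t * rho n * eta by rewrite /t [RHS]mulrAC divfK// gt_eqF.
  by rewrite ler_pM2l.
split=> //.
apply: (@bigO_P_cvg0 R d T P _ (minimax_rate k)) => //.
  by move=> n w; exact: avg_sq_error_ge0.
apply/cvgrPdist_le => e e0; near=> n.
have n0 : (0 < n)%N by near: n; exact: nbhs_infty_gt.
have nR0 : 0 < n%:R :> R by rewrite ltr0n.
have n1 : 1 <= rho n by apply: powR_root_ge => //; rewrite expr1n ler1n.
rewrite sub0r normrN ger0_norm ?(ltW (rate0 n n0))// rate// ler_pdivrMr//.
have large : e^-1 <= rho n.
  apply: powR_root_ge; first by rewrite invr_ge0 ltW.
  near: n; exact: nbhs_infty_ger.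
rewrite -[X in _ <= _ * X](powR_root k) -/(rho n) (_ : 2 * k + 3 = (2 * k + 1).+2)%N; last by rewrite addn3 addn1.
rewrite !exprS mulrCA ler_peMr// mulrA.
rewrite -[1]mulr1; apply: ler_pM => //; last exact: exprn_ege1.
by rewrite mulrC -ler_pdivrMr// mul1r.
Unshelve. all: by end_near. Qed.
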